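(* Let $V$ be a unital JB-algebra with positive cone $\Omega$. Define $F:G(\Omega)\times[0,1]\to G(\Omega)$ by $F(g,t)=U_{e^{-t\ln(g(1))/2}}\, g$. Then $\mathrm{Aut}(V)$ is a strong deformation retract of $G(\Omega)$ by means of $F$. In particular $G(\Omega)$ and $\mathrm{Aut}(V)$ have the same number of connected components.
   Context: A (unital) JB-algebra is a real Jordan algebra $(V,\circ)$ with unit $1$ (the product is bilinear, commutative and $x^2\circ(x\circ y)=x\circ(x^2\circ y)$) with a complete norm such that $\|x\circ y\|\le\|x\|\|y\|$, $\|x^2\|=\|x\|^2$, $\|x^2\|\le\|x^2+y^2\|$; it may be infinite dimensional. $GL(V)$ is the group of bounded invertible linear operators on $V$, with the operator norm topology. $L_xy=x\circ y$, $U_x=2L_x^2-L_{x^2}$. An element $x$ is invertible if $U_x$ is an invertible operator, $\sigma(x)=\{\lambda\in\mathbb R: x-\lambda1\text{ not invertible}\}$, and $\Omega=\{x\in V:\sigma(x)\subset(0,+\infty)\}$. By continuous functional calculus, $\exp:V\to\Omega$ is a bijection, with inverse denoted $\ln:\Omega\to V$. $G(\Omega)=\{g\in GL(V): g(\Omega)=\Omega\}$, and $\mathrm{Aut}(V)$ is the group of $k\in GL(V)$ with $k(a\circ b)=k(a)\circ k(b)$ for all $a,b\in V$; one has $\mathrm{Aut}(V)\subset G(\Omega)$. *)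

(* Defs.v *)
From HB Require Import structures.
From mathcomp Require Import all_boot all_order all_algebra.
From mathcomp Require Import all_classical all_reals all_analysis.

Set Implicit Arguments.
Unset Strict Implicit.
Unset Printing Implicit Defensive.

Import Order.TTheory GRing.Theory Num.Theory.
Import numFieldNormedType.Exports.

Local Open Scope classical_set_scope.
Local Open Scope ring_scope.

Section BoundedOperators.
Context {R : realType} {V : normedModType R}.

Definition bounded_linear (f : V -> V) : Prop :=
  linear f /\ exists M : R, forall x, `|f x| <= M * `|x|.

Definition bounded_linear_pred : {pred V -> V} :=
  [pred f | `[< bounded_linear f >]].

Lemma bounded_linear_submod : submod_closed bounded_linear_pred.
Proof.
split.
  apply/asboolP; split; first by move=> a x y /=; rewrite scaler0 addr0.
  by exists 0 => x; rewrite mul0r normr0.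
move=> a f g /asboolP[lf [M fM]] /asboolP[lg [N gN]]; apply/asboolP; split.
  move=> b x y; rewrite !fctE lf lg !scalerDr !scalerA (mulrC a b) -!addrA.
  by congr (_ + _); rewrite addrCA.
exists (`|a| * M + N) => x; rewrite !fctE (le_trans (ler_normD _ _))//.
by rewrite mulrDl lerD// normrZ -mulrA ler_wpM2l.
Qed.

HB.instance Definition _ :=
  GRing.isSubmodClosed.Build _ _ bounded_linear_pred bounded_linear_submod.

End BoundedOperators.

(* The bounded operators L(V); the instance Lmodule_isNormed below gives them
   the operator norm and its topology, which GL(V) and its subsets inherit. *)
Record bop (R : realType) (V : normedModType R) := Bop {
  bop_fun :> V -> V;
  bop_subproof : bop_fun \in bounded_linear_pred
}.

Section BopTheory.
Context {R : realType} {V : normedModType R}.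

HB.instance Definition _ := [isSub for @bop_fun R V].
HB.instance Definition _ := [Choice of bop V by <:].
HB.instance Definition _ := [SubChoice_isSubLmodule of bop V by <:].

Lemma bopP (f : bop V) : bounded_linear f.
Proof. by case: f => f /= /asboolP. Qed.

HB.instance Definition _ (f : bop V) :=
  GRing.isLinear.Build R V V *:%R f (bopP f).1.

Lemma bopE (f g : bop V) : f =1 g -> f = g.
Proof. by move=> fg; apply: val_inj; apply/funext. Qed.

Definition opnorm (f : bop V) : R :=
  sup [set `|f x| | x in [set x : V | `|x| <= 1]].

Lemma opnorm_has_sup (f : bop V) :
  has_sup [set `|f x| | x in [set x : V | `|x| <= 1]].
Proof.
split; first by exists `|f 0|, 0 => //=; rewrite normr0.
have [_ [M fM]] := bopP f.
exists `|M| => _ [x /= x1 <-]; rewrite (le_trans (fM x))//.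
rewrite (le_trans (ler_norm _))// normrM normr_id.
by rewrite -[leRHS]mulr1 ler_wpM2l.
Qed.

Lemma opnorm_ge (f : bop V) x : `|x| <= 1 -> `|f x| <= opnorm f.
Proof. by move=> x1; apply: (sup_upper_bound (opnorm_has_sup f)); exists x. Qed.

Lemma opnorm_le (f : bop V) (c : R) :
  (forall x, `|x| <= 1 -> `|f x| <= c) -> opnorm f <= c.
Proof.
move=> fc; apply: ge_sup; first by have [] := opnorm_has_sup f.
by move=> _ [x /= x1 <-]; exact: fc.
Qed.

Lemma opnorm_apply (f : bop V) x : `|f x| <= opnorm f * `|x|.
Proof.
have [->|x0] := eqVneq x 0; first by rewrite linear0 !normr0 mulr0.
have nx : 0 < `|x| by rewrite normr_gt0.
rewrite -ler_pdivrMr// mulrC.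
have -> : `|x|^-1 * `|f x| = `|f (`|x|^-1 *: x)|.
  by rewrite linearZ normrZ gtr0_norm ?invr_gt0.
by apply: opnorm_ge; rewrite normrZ gtr0_norm ?invr_gt0// mulVf ?gt_eqF.
Qed.

Lemma opnormD (f g : bop V) : opnorm (f + g) <= opnorm f + opnorm g.
Proof.
apply: opnorm_le => x x1; rewrite (le_trans (ler_normD _ _))//.
by rewrite lerD// opnorm_ge.
Qed.

Lemma opnormZ (a : R) (f : bop V) : opnorm (a *: f) = `|a| * opnorm f.
Proof.
have le (b : R) (g : bop V) : opnorm (b *: g) <= `|b| * opnorm g.
  apply: opnorm_le => x x1; have -> : (b *: g) x = b *: g x by [].
  by rewrite normrZ ler_wpM2l// opnorm_ge.
apply/eqP; rewrite eq_le le/=.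
have [->|a0] := eqVneq a 0.
  rewrite normr0 mul0r (le_trans _ (@opnorm_ge _ 0 _))// normr0//.
rewrite -ler_pdivlMl ?normr_gt0// -normfV.
by rewrite -[f in leLHS]scale1r -(mulVf a0) -scalerA le.
Qed.

Lemma opnorm_eq0 (f : bop V) : opnorm f = 0 -> f = 0.
Proof.
move=> f0; apply: bopE => x; apply/eqP; rewrite -normr_le0.
by rewrite (le_trans (opnorm_apply f x))// f0 mul0r.
Qed.

HB.instance Definition _ :=
  Lmodule_isNormed.Build R (bop V) opnormD opnormZ opnorm_eq0.

Lemma bop_id_subproof : (id : V -> V) \in bounded_linear_pred.
Proof. by apply/asboolP; split => //; exists 1 => x; rewrite mul1r. Qed.

Definition bop_id : bop V := Bop bop_id_subproof.

Lemma bop_comp_subproof (f g : bop V) : f \o g \in bounded_linear_pred.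
Proof.
apply/asboolP; split=> [a x y|]; first by rewrite /= !linearP.
exists (opnorm f * opnorm g) => x /=.
rewrite (le_trans (opnorm_apply _ _))// -mulrA ler_wpM2l ?opnorm_apply//.
by rewrite (le_trans _ (@opnorm_ge f 0 _))// normr0.
Qed.

Definition bop_comp (f g : bop V) : bop V := Bop (bop_comp_subproof f g).

Definition GL : set (bop V) :=
  [set g | exists h : bop V, bop_comp g h = bop_id /\ bop_comp h g = bop_id].

End BopTheory.

Arguments GL {R} V.

HB.mixin Record isJBAlgebra (R : realType) V of CompleteNormedModule R V := {
  jmul : V -> V -> V;
  jone : V;
  jmulC : commutative jmul;
  jmul_linearr : forall x, linear (jmul x);
  jmul1x : left_id jone jmul;
  jordan_identity : forall x y,
    jmul (jmul x x) (jmul x y) = jmul x (jmul (jmul x x) y);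
  jnorm_mul : forall x y, `|jmul x y| <= `|x| * `|y|;
  jnorm_sqr : forall x, `|jmul x x| = `|x| ^+ 2;
  jnorm_sqrD : forall x y, `|jmul x x| <= `|jmul x x + jmul y y|
}.

#[short(type="jbAlgebraType")]
HB.structure Definition JBAlgebra (R : realType) :=
  { V of isJBAlgebra R V & CompleteNormedModule R V }.

Section JBAlgebraDefs.
Context {R : realType} {V : jbAlgebraType R}.
Implicit Types x y : V.

Lemma jL_subproof x : jmul x \in bounded_linear_pred.
Proof.
apply/asboolP; split; first exact: jmul_linearr.
by exists `|x| => y; exact: jnorm_mul.
Qed.

Definition jL x : bop V := Bop (jL_subproof x).

Definition jU x : bop V := 2 *: bop_comp (jL x) (jL x) - jL (jmul x x).

Definition jinvertible x : Prop := GL V (jU x).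

Definition jspectrum x : set R := [set l | ~ jinvertible (x - l *: jone)].

Definition jcone : set V := [set x | jspectrum x `<=` [set l | 0 < l]].

Definition jpow x (n : nat) : V := iter n (jmul x) jone.

(* The power series exp agrees with the continuous functional calculus, since
   its partial sums converge uniformly on the compact set jspectrum x. *)
Definition jexp x : V :=
  limn (series (fun n => n`!%:R^-1 *: jpow x n)).

(* Inverse of jexp; only meaningful on jcone, the range of jexp. *)
Definition jln y : V := xget 0 [set x | jexp x = y].

Definition Gcone : set (bop V) := [set g | GL V g /\ g @` jcone = jcone].

Definition jAut : set (bop V) :=
  [set k | GL V k /\ forall a b, k (jmul a b) = jmul (k a) (k b)].

Definition retraction_map (p : bop V * R) : bop V :=
  bop_comp (jU (jexp (- (p.2 / 2) *: jln (p.1 jone)))) p.1.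

End JBAlgebraDefs.

Definition strong_deformation_retract (R : realType) (T : topologicalType)
    (X A : set T) (F : T * R -> T) : Prop :=
  [/\ A `<=` X,
      {within X `*` `[0, 1]%classic, continuous F},
      forall x t, X x -> 0 <= t <= 1 -> X (F (x, t)),
      forall x, X x -> F (x, 0) = x /\ A (F (x, 1)) &
      forall a t, A a -> 0 <= t <= 1 -> F (a, t) = a].

Definition connected_components (T : topologicalType) (A : set T) :
    set (set T) :=
  connected_component A @` A.

(* Main.v *)
(* The positive cone is [exp V], and [U_{exp x}] is an automorphism of it.
   Identities between one-parameter families such as [exp (t x)] and
   [U_{exp (t x)}] are proved by differentiating in [t]: this yields
   [U_{exp x} U_{exp (-x)} = 1] and the fundamental formula
   [U_{U_{exp x} y} = U_{exp x} U_y U_{exp x}] from the linearized Jordan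
   identity alone.  Hence [U_{exp (- ln (g 1) / 2)} g] fixes the unit.

   A cone automorphism [g] fixing the unit preserves the Thompson metric, for
   which [x |-> U_m x^-1] are point reflections; the Mazur-Ulam argument shows
   that [g] commutes with inversion, and
   [a - a^2 = (a^-1 + (1 - a)^-1)^-1] then shows that it preserves squares.

   Continuity of [F] comes from the local expression of [ln] as a power series,
   and a strong deformation retract has the same components. *)
From HB Require Import structures.
Require Import Defs.
From mathcomp Require Import all_boot all_order all_algebra.
From mathcomp Require Import all_classical all_reals all_analysis.
From mathcomp Require Import ring lra.

Set Implicit Arguments.
Unset Strict Implicit.
Unset Printing Implicit Defensive.

Import Order.TTheory GRing.Theory Num.Theory.
Import numFieldNormedType.Exports.

Local Open Scope classical_set_scope.
Local Open Scope ring_scope.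

(** Neither a spectral theorem nor Macdonald's principle enters. Scalar calculations take place in
    the closed subalgebra generated by one element, which is associative and whose multiplication
    operators commute; the power series of exp and of ln (1 - a) suffice there. Elements without a
    common such subalgebra meet mainly through the operators U. This is where the fundamental
    formula is needed, and exponentials are enough because every element of the cone is one.

    The definition of the cone speaks only of the invertibility of operators U, which carries no
    order. The order comes from the norm: b is positive when |al 1 - b| <= al for some al, and the
    axiom |x^2| <= |x^2 + y^2|, applied with y an exponential square root, yields its properties.
    The two descriptions are joined by connectedness: a path of elements with invertible U that
    starts in the interior of the positive elements cannot reach the boundary. *)

Section ModuleExpressions.
Context {R : comNzRingType} {V : lmodType R}.

(** Syntax for linear combinations of atoms, by which a vector identity is reduced to one scalar
    identity per atom. *)
Inductive lexpr :=
  | LAtom of nat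
  | LZero
  | LAdd of lexpr & lexpr
  | LOpp of lexpr
  | LMuln of lexpr & nat
  | LScale of R & lexpr.

Fixpoint leval (env : seq V) e : V :=
  match e with
  | LAtom n => env`_n
  | LZero => 0
  | LAdd a b => leval env a + leval env b
  | LOpp a => - leval env a
  | LMuln a n => leval env a *+ n
  | LScale c a => c *: leval env a
  end.

Fixpoint lcoef e (i : nat) : R :=
  match e with
  | LAtom n => if n == i then 1 else 0
  | LZero => 0
  | LAdd a b => lcoef a i + lcoef b i
  | LOpp a => - lcoef a i
  | LMuln a n => n%:R * lcoef a i
  | LScale c a => c * lcoef a i
  end.

Lemma leval_coef env e :
  leval env e = \sum_(0 <= i < size env) lcoef e i *: env`_i.
Proof.
elim: e => /= [n| |a -> b ->|a ->|a -> n|c a ->].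
- have [ns|ns] := ltnP n (size env).
    rewrite (bigD1_seq n) ?iota_uniq ?mem_index_iota//= eqxx scale1r big1 ?addr0//.
    by move=> i; rewrite eq_sym => /negbTE ->; rewrite scale0r.
  rewrite nth_default// big_nat big1// => i /andP[_ si].
  by rewrite gtn_eqF ?scale0r// (leq_trans si).
- by rewrite big1// => i _; rewrite scale0r.
- by rewrite -big_split; apply: eq_bigr => i _; rewrite scalerDl.
- by rewrite -sumrN; apply: eq_bigr => i _; rewrite scaleNr.
- by rewrite -sumrMnl; apply: eq_bigr => i _; rewrite -scalerA scaler_nat.
- by rewrite scaler_sumr; apply: eq_bigr => i _; rewrite scalerA.
Qed.

Lemma leval_eq env e f :
  foldr (fun i P => lcoef e i = lcoef f i /\ P) True (iota 0 (size env)) ->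
  leval env e = leval env f.
Proof.
move=> ef; rewrite !leval_coef big_seq [RHS]big_seq; apply: eq_bigr => i.
rewrite /index_iota subn0; elim: (iota 0 (size env)) ef => //= j s IHs [ji ef].
by rewrite inE => /orP[/eqP ->|/(IHs ef)//]; rewrite ji.
Qed.

(** Certificate form: the goal is exhibited as a multiple of a known equation, and comparing
    coefficients does the rest. *)
Lemma lin_comb1 (x y a b : V) (c : R) :
  a = b -> x - y = c *: (a - b) -> x = y.
Proof. by move=> ->; rewrite subrr scaler0 => /subr0_eq. Qed.

Lemma lin_comb2 (x y a b a' b' : V) (c c' : R) : a = b -> a' = b' ->
  x - y = c *: (a - b) + c' *: (a' - b') -> x = y.
Proof. by move=> -> ->; rewrite !subrr !scaler0 addr0 => /subr0_eq. Qed.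

End ModuleExpressions.

Ltac lm_index x l :=
  match l with
  | x :: _ => constr:(0%N)
  | _ :: ?l' => let n := lm_index x l' in constr:(S n)
  end.

Ltac lm_insert x l :=
  match l with
  | context [x :: _] => l
  | _ => constr:(x :: l)
  end.

Ltac lm_atoms e l :=
  match e with
  | @GRing.add _ ?a ?b => let l' := lm_atoms a l in lm_atoms b l'
  | @GRing.opp _ ?a => lm_atoms a l
  | @GRing.natmul _ ?a _ => lm_atoms a l
  | @GRing.scale _ _ _ ?a => lm_atoms a l
  | @GRing.zero _ => l
  | _ => lm_insert e l
  end.

Ltac lm_reify R e l :=
  match e with
  | @GRing.add _ ?a ?b =>
      let a' := lm_reify R a l in let b' := lm_reify R b l in
      constr:(@LAdd R a' b')
  | @GRing.opp _ ?a => let a' := lm_reify R a l in constr:(@LOpp R a')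
  | @GRing.natmul _ ?a ?n =>
      let a' := lm_reify R a l in constr:(@LMuln R a' n)
  | @GRing.scale _ _ ?c ?a =>
      let a' := lm_reify R a l in constr:(@LScale R c a')
  | @GRing.zero _ => constr:(@LZero R)
  | _ => let n := lm_index e l in constr:(@LAtom R n)
  end.

(* [lmod R] proves an equality of linear combinations with coefficients in the
   commutative ring [R] by comparing coefficients. *)
Ltac lmod R :=
  match goal with
  | |- @eq ?T ?a ?b =>
    let l0 := constr:(@nil T) in
    let l1 := lm_atoms a l0 in let l := lm_atoms b l1 in
    let a' := lm_reify R a l in let b' := lm_reify R b l in
    change (leval l a' = leval l b'); apply: leval_eq; cbn -[GRing.add GRing.mul
      GRing.opp GRing.zero GRing.one GRing.natmul GRing.inv];
    repeat split; first [ring | lra | field]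
  end.

Notation "x ** y" := (jmul x y) (at level 40, left associativity).
Notation "'\e'" := jone (at level 0).

(** * Linearized Jordan identities and the operator U *)

Section JordanIdentities.
Context {R : realType} {V : jbAlgebraType R}.
Implicit Types (a b u v w x y z : V) (c : R).

Lemma jmulDr x y z : x ** (y + z) = x ** y + x ** z.
Proof. by have := jmul_linearr x 1 y z; rewrite !scale1r. Qed.

Lemma jmul0r x : x ** 0 = 0.
Proof. by apply: (@addIr _ (x ** 0)); rewrite -jmulDr !add0r. Qed.

Lemma jmulZr c x y : x ** (c *: y) = c *: (x ** y).
Proof. by have := jmul_linearr x c y 0; rewrite jmul0r !addr0. Qed.

Lemma jmulNr x y : x ** (- y) = - (x ** y).
Proof. by rewrite -scaleN1r jmulZr scaleN1r. Qed.

Lemma jmulDl x y z : (y + z) ** x = y ** x + z ** x.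
Proof. by rewrite jmulC jmulDr !(jmulC x). Qed.

Lemma jmul0l x : 0 ** x = 0.
Proof. by rewrite jmulC jmul0r. Qed.

Lemma jmulZl c x y : (c *: y) ** x = c *: (y ** x).
Proof. by rewrite jmulC jmulZr jmulC. Qed.

Lemma jmulNl x y : (- y) ** x = - (y ** x).
Proof. by rewrite jmulC jmulNr jmulC. Qed.

Lemma jmulx1 x : x ** \e = x.
Proof. by rewrite jmulC jmul1x. Qed.

Definition jbil :=
  (jmulDr, jmulDl, jmulZr, jmulZl, jmulNr, jmulNl, jmul0r, jmul0l).

(** Half the difference of the Jordan identities at x + z and x - z consists of the part linear in z
    and the cubic instance at z, which is subtracted. *)
Lemma jordan_lin1 x y z :
  (x ** x) ** (z ** y) + 2 *: ((x ** z) ** (x ** y)) =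
  z ** ((x ** x) ** y) + 2 *: (x ** ((x ** z) ** y)).
Proof.
have := jordan_identity (x + z) y; have := jordan_identity (x - z) y.
have := jordan_identity z y.
rewrite !jbil !(jmulC z x) => e1 e2 e3.
apply: (@lin_comb2 R V _ _ _ _ _ _ (2^-1) (-2^-1) e3 e2).
apply: (@lin_comb1 R V _ _ _ _ (-1) e1).
lmod R.
Qed.

(** Polarization of the square that remains in [jordan_lin1]. *)
Lemma jordan_lin x y z w :
  (x ** y) ** (z ** w) + (y ** z) ** (x ** w) + (z ** x) ** (y ** w) =
  x ** ((y ** z) ** w) + y ** ((z ** x) ** w) + z ** ((x ** y) ** w).
Proof.
have := jordan_lin1 (x + y) w z; have := jordan_lin1 x w z.
have := jordan_lin1 y w z.
rewrite !jbil !(jmulC z x) !(jmulC y x) => e1 e2 e3.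
apply: (@lin_comb2 R V _ _ _ _ _ _ (2^-1) (-2^-1) e3 e2).
apply: (@lin_comb1 R V _ _ _ _ (-2^-1) e1).
lmod R.
Qed.

(** As an operator identity in z: multiplication by a triple product is a polynomial in the
    multiplications by the three factors and by their pairwise products. *)
Lemma jmul_mul x y w z : ((x ** y) ** w) ** z =
  (x ** y) ** (w ** z) + (x ** w) ** (y ** z) + (y ** w) ** (x ** z)
  - x ** (w ** (y ** z)) - y ** (w ** (x ** z)).
Proof.
have := jordan_lin x y z w.
rewrite (jmulC z w) (jmulC ((y ** z))) (jmulC (y ** z) w) (jmulC (z ** x) w).
rewrite (jmulC (z ** x)) (jmulC z x) (jmulC z) => e1.
by apply: (@lin_comb1 R V _ _ _ _ (-1) e1); lmod R.
Qed.

Definition U x y := 2 *: (x ** (x ** y)) - (x ** x) ** y.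

Lemma jUE x y : jU x y = U x y.
Proof. by []. Qed.

(** The left side is the derivative of U at y in the direction of the product of x and y, so the
    identity reads 2 U_{xy,y} = L_x U_y + U_y L_x. *)
Lemma U_deriv x y z :
  2 *: ((x ** y) ** (y ** z) + y ** ((x ** y) ** z) - (y ** (x ** y)) ** z) =
  x ** U y z + U y (x ** z).
Proof.
have e1 := jmul_mul x y y z; have e2 := jordan_lin1 y z x.
rewrite /U !jbil (jmulC y (x ** y)).
rewrite (jmulC y x) in e2.
apply: (@lin_comb2 R V _ _ _ _ _ _ (-2) (-1) e1 e2).
lmod R.
Qed.

Definition opcomm x y := forall z, x ** (y ** z) = y ** (x ** z).

Lemma opcommC x y : opcomm x y -> opcomm y x.
Proof. by move=> xy z; rewrite xy. Qed.

Lemma opcomm_assoc x y z : opcomm x z -> (x ** y) ** z = x ** (y ** z).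
Proof. by move=> xz; rewrite jmulC -xz (jmulC z). Qed.

(** With a = exp (t w), this is the differential equation of U along an exponential. *)
Lemma U_deriv_comm w a z : opcomm w a -> opcomm w (a ** a) ->
  opcomm w (w ** a) -> opcomm a (w ** a) ->
  2 *: ((w ** a) ** (a ** z) + a ** ((w ** a) ** z) - (a ** (w ** a)) ** z) =
  2 *: (w ** U a z).
Proof.
move=> wa waa wwa awa; rewrite U_deriv /U !jbil -!wa -waa; lmod R.
Qed.

End JordanIdentities.

(** * Continuity criteria in normed modules *)

Section Continuity.
Context {R : realType}.

Lemma lipschitz_near_continuous (V W : normedModType R) (f : V -> W) x (K e : R) :
  0 < e -> (forall y, `|x - y| <= e -> `|f x - f y| <= K * `|x - y|) ->
  {for x, continuous f}.
Proof.
move=> e0 fK; apply/cvgrPdist_le => d d0; near=> y.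
have xy : `|x - y| <= e by near: y; apply: cvgr_dist_le.
rewrite (le_trans (fK _ xy))//.
have K0 : 0 < `|K| + 1 by rewrite ltr_wpDl.
have : `|x - y| <= d / (`|K| + 1).
  by near: y; apply: cvgr_dist_le => //; rewrite divr_gt0.
rewrite ler_pdivlMr// => /(le_trans _); apply; rewrite mulrC ler_wpM2l//.
by rewrite (le_trans (ler_norm _))// lerDl.
Unshelve. all: by end_near. Qed.

(** Serves both the Jordan product and the composition of operators. *)
Lemma cvg_bounded_bilinear (T : Type) (F : set_system T) (FF : Filter F)
    (V W X : normedModType R) (B : V -> W -> X) (f : T -> V) (g : T -> W) a b :
  (forall u v w, B (u - v) w = B u w - B v w) ->
  (forall u v w, B u (v - w) = B u v - B u w) ->
  (forall u v, `|B u v| <= `|u| * `|v|) ->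
  f @ F --> a -> g @ F --> b -> B (f x) (g x) @[x --> F] --> B a b.
Proof.
move=> Bl Br Bn fa gb; apply/cvgrPdist_le => d d0.
pose M := `|a| + `|b| + 1.
have M0 : 0 < M by rewrite ltr_wpDl ?addr_ge0.
have dM : 0 < d / 2 / M by rewrite divr_gt0// divr_gt0.
move/cvgrPdist_le: fa => /(_ _ dM) fa; move/cvgrPdist_le: gb => gb.
move: fa (gb _ dM) (gb _ ltr01); apply: filterS3 => x fx gx' gb1.
have -> : B a b - B (f x) (g x) = B (a - f x) (g x) + B a (b - g x).
  by rewrite Bl Br; lmod R.
have gx : `|g x| <= M.
  rewrite distrC in gb1; rewrite -(subrK b (g x)) (le_trans (ler_normD _ _))//.
  by rewrite /M; have := normr_ge0 a; lra.
have ax : `|a| <= M by rewrite /M; have := normr_ge0 b; lra.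
rewrite (le_trans (ler_normD _ _))// [leRHS](splitr d) lerD// (le_trans (Bn _ _))//.
  by rewrite -[leRHS](divfK (lt0r_neq0 M0)) ler_pM.
by rewrite mulrC -[leRHS](divfK (lt0r_neq0 M0)) ler_pM.
Qed.

Lemma closed_eqfun (T : topologicalType) (W : normedModType R) (f g : T -> W) :
  continuous f -> continuous g -> closed [set x | f x = g x].
Proof.
move=> fc gc; rewrite (_ : mkset _ = (fun x => f x - g x) @^-1` [set 0]).
  apply: closed_comp => [x _|]; first by apply: cvgB; [exact: fc|exact: gc].
  by apply: accessible_closed_set1; exact/hausdorff_accessible/norm_hausdorff.
apply/seteqP; split => x /=; first by move=> ->; rewrite subrr.
by move/subr0_eq.
Qed.

End Continuity.

(** * The closed associative subalgebra generated by one element *)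

Section GeneratedAlgebra.
Context {R : realType} {V : jbAlgebraType R}.
Implicit Types (a b u v w x y z : V) (c : R).

Lemma cvg_jmul (T : Type) (F : set_system T) (FF : Filter F) (f g : T -> V) a b :
  f @ F --> a -> g @ F --> b -> f x ** g x @[x --> F] --> a ** b.
Proof.
apply: cvg_bounded_bilinear => [u v w|u v w|u v]; rewrite ?jbil//.
exact: jnorm_mul.
Qed.

Lemma jmul_continuous a : continuous (jmul a).
Proof. by move=> x; apply: cvg_jmul; [exact: cvg_cst|exact: cvg_id]. Qed.

Lemma jmulr_continuous a : continuous (jmul^~ a).
Proof. by move=> x; apply: cvg_jmul; [exact: cvg_id|exact: cvg_cst]. Qed.

Definition jsubspace (S : set V) :=
  closed S /\ forall c u v, S u -> S v -> S (c *: u + v).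

(* The closed subalgebra generated by [a]; stability under multiplication by
   [a] alone makes the induction principle [alg_ind] easy to apply. *)
Variant alg a z : Prop :=
  Alg of forall S : set V, jsubspace S -> S \e ->
    (forall u, S u -> S (a ** u)) -> S z.

Lemma alg_ind a (S : set V) : jsubspace S -> S \e ->
  (forall u, S u -> S (a ** u)) -> alg a `<=` S.
Proof. by move=> SS S1 Sa z []; apply. Qed.

Lemma alg_subspace a : jsubspace (alg a).
Proof.
split; last by move=> c u v [au] [av]; split=> S SS S1 Sa;
  apply: SS.2; [exact: au|exact: av].
rewrite (_ : alg a = \bigcap_(S in [set S |
    [/\ jsubspace S, S \e & forall u, S u -> S (a ** u)]]) S).
  by apply: closed_bigI => S [[]].
apply/seteqP; split => [z [az] S [] |z az]; first exact: az.
by split=> S SS S1 Sa; exact: az.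
Qed.

Lemma alg1 a : alg a \e.
Proof. by split. Qed.

Lemma algl a u : alg a u -> alg a (a ** u).
Proof. by move=> [au]; split=> S SS S1 Sa; apply: (Sa); exact: au. Qed.

Lemma alg_id a : alg a a.
Proof. by have := algl (alg1 a); rewrite jmulx1. Qed.

Lemma algD a u v : alg a u -> alg a v -> alg a (u + v).
Proof. by move=> au av; rewrite -(scale1r u); apply: (alg_subspace a).2. Qed.

Lemma alg0 a : alg a 0.
Proof.
by rewrite -(subrr \e) addrC -scaleN1r; apply: (alg_subspace a).2; exact: alg1.
Qed.

Lemma algZ a c u : alg a u -> alg a (c *: u).
Proof.
by move=> au; rewrite -(addr0 (_ *: _)); apply: (alg_subspace a).2 (alg0 _).
Qed.

Lemma algN a u : alg a u -> alg a (- u).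
Proof. by rewrite -scaleN1r; exact: algZ. Qed.

Lemma algB a u v : alg a u -> alg a v -> alg a (u - v).
Proof. by move=> au /algN; exact: algD. Qed.

Lemma opcomm_subspace w : jsubspace (opcomm w).
Proof.
split.
  rewrite (_ : opcomm w = \bigcap_z [set x | w ** (x ** z) = x ** (w ** z)]).
    apply: closed_bigI => z _; apply: closed_eqfun => x.
      apply: (continuous_comp (@jmulr_continuous z x)).
      exact: jmul_continuous.
    exact: jmulr_continuous.
  by apply/seteqP; split => x /= xw z; [move=> _|]; apply: xw.
by move=> c u v wu wv z; rewrite !jbil wu wv.
Qed.

Lemma opcomm1 w : opcomm w \e.
Proof. by move=> z; rewrite !jmul1x. Qed.

Lemma opcomm_mul w x y :
  opcomm w x -> opcomm w y -> opcomm w (x ** y) -> opcomm w (x ** x) ->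
  opcomm w (x ** (x ** y)).
Proof.
move=> wx wy wxy wxx z; rewrite (jmulC x (x ** y)) (jmulC x y).
rewrite !jmul_mul !jbil (jmulC y x).
by rewrite !(wxy, wx, wy, wxx).
Qed.

Lemma opcomm_alg a w : opcomm w a -> opcomm w (a ** a) -> alg a `<=` opcomm w.
Proof.
(* The recursion given by [opcomm_mul] has order two, so the induction carries [a ** z] along with
   [z]. *)
move=> wa waa; set S := [set z | opcomm w z /\ opcomm w (a ** z)].
suff: alg a `<=` S by move=> aS z /aS[].
apply: alg_ind.
- split.
    rewrite (_ : S = opcomm w `&` jmul a @^-1` opcomm w)//.
    apply: closedI; first exact: (opcomm_subspace w).1.
    apply: closed_comp (opcomm_subspace w).1 => x _; exact: jmul_continuous.
  move=> c u v [wu wau] [wv wav]; split; first exact: (opcomm_subspace w).2.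
  by rewrite !jbil; exact: (opcomm_subspace w).2.
- by split; [exact: opcomm1|rewrite jmulx1].
- by move=> u [wu wau]; split => //; exact: opcomm_mul.
Qed.

Lemma opcomm_sqr a : opcomm a (a ** a).
Proof. by move=> z; rewrite jordan_identity. Qed.

(** [opcomm_alg] is applied in two rounds: z is shown to commute with a and with its square,
    starting from the Jordan identity; then z itself is the fixed operator. *)
Lemma alg_opcomm a z w : alg a z -> alg a w -> opcomm z w.
Proof.
move=> az; have aa : opcomm a a by [].
have za : opcomm z a.
  by apply/opcommC/(opcomm_alg _ _ az) => //; exact: opcomm_sqr.
apply: opcomm_alg => //; apply/opcommC/(opcomm_alg _ _ az) => //.
exact/opcommC/opcomm_sqr.
Qed.

Lemma algM a z w : alg a z -> alg a w -> alg a (z ** w).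
Proof.
move=> az aw; apply: (@alg_ind a [set z | alg a z /\ alg a (z ** w)] _ _ _ z az).2.
- split.
    rewrite (_ : mkset _ = alg a `&` jmul^~ w @^-1` alg a)//.
    apply: closedI; first exact: (alg_subspace a).1.
    apply: closed_comp (alg_subspace a).1 => x _; exact: jmulr_continuous.
  move=> c u v [au auw] [av avw]; split; first exact: (alg_subspace a).2.
  by rewrite !jbil; exact: (alg_subspace a).2.
- by split; [exact: alg1|rewrite jmul1x].
- move=> u [au auw]; split; first exact: algl.
  by rewrite (opcomm_assoc _ (alg_opcomm (alg_id a) aw)); exact: algl.
Qed.

Lemma algA a x y z : alg a x -> alg a z -> (x ** y) ** z = x ** (y ** z).
Proof. by move=> ax az; apply/opcomm_assoc/(alg_opcomm ax az). Qed.

Lemma algCA a x y z : alg a x -> alg a y -> x ** (y ** z) = y ** (x ** z).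
Proof. by move=> ax ay; apply: (alg_opcomm ax ay). Qed.

Lemma alg_trans a b : alg a b -> alg b `<=` alg a.
Proof.
move=> ab; apply: alg_ind; [exact: alg_subspace|exact: alg1|].
by move=> u; exact: algM.
Qed.

End GeneratedAlgebra.

(** * Differential calculus with quadratic remainders *)

Section QuadraticIncrements.
Context {R : realType}.
Implicit Types (s t : R).

(* The quadratic remainder makes [dq_const] a telescoping sum, so that no mean
   value inequality for vector-valued maps is needed. *)
Definition dq (W : normedModType R) (f f' : R -> W) :=
  exists C, forall s t, 0 <= s <= 1 -> 0 <= t <= 1 ->
    [/\ `|f s| <= C, `|f' s| <= C &
        `|f t - f s - (t - s) *: f' s| <= C * (t - s) ^+ 2].

Section NormedModule.
Context {W : normedModType R}.
Implicit Types f g : R -> W.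

Lemma dq_ext f f' g g' : (forall t, 0 <= t <= 1 -> g t = f t) ->
  (forall t, 0 <= t <= 1 -> g' t = f' t) -> dq f f' -> dq g g'.
Proof.
by move=> fg fg' [C fC]; exists C => s t s1 t1; rewrite !fg// !fg'//; exact: fC.
Qed.

Lemma dq_ge0 f f' C : (forall s t, 0 <= s <= 1 -> 0 <= t <= 1 ->
    [/\ `|f s| <= C, `|f' s| <= C &
        `|f t - f s - (t - s) *: f' s| <= C * (t - s) ^+ 2]) -> 0 <= C.
Proof.
have h : 0 <= (0 : R) <= 1 by rewrite lexx ler01.
by move/(_ 0 0 h h) => [+ _ _]; apply: le_trans.
Qed.

Lemma dq_cst (c : W) : dq (fun=> c) (fun=> 0).
Proof.
exists `|c| => s t _ _; rewrite normr0 scaler0 subr0 subrr normr0.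
by rewrite mulr_ge0// sqr_ge0.
Qed.

Lemma dqD f f' g g' : dq f f' -> dq g g' ->
  dq (fun t => f t + g t) (fun t => f' t + g' t).
Proof.
move=> [C fC] [D gD]; exists (C + D) => s t s1 t1.
have [f1 f2 f3] := fC s t s1 t1; have [g1 g2 g3] := gD s t s1 t1.
split; [by rewrite (le_trans (ler_normD _ _))// lerD..|].
rewrite (_ : _ - _ = (f t - f s - (t - s) *: f' s) + (g t - g s - (t - s) *: g' s)).
  by rewrite (le_trans (ler_normD _ _))// mulrDl lerD.
by lmod R.
Qed.

Lemma dqZ f f' c : dq f f' -> dq (fun t => c *: f t) (fun t => c *: f' t).
Proof.
move=> [C fC]; exists (`|c| * C) => s t s1 t1.
have [f1 f2 f3] := fC s t s1 t1; rewrite !normrZ !ler_wpM2l//; split => //.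
rewrite scalerA mulrC -scalerA -!scalerBr normrZ -mulrA ler_wpM2l//.
Qed.

Lemma dqN f f' : dq f f' -> dq (fun t => - f t) (fun t => - f' t).
Proof.
by move=> /(dqZ (-1)); apply: dq_ext => t _; rewrite scaleN1r.
Qed.

Lemma dq_const f f' : dq f f' -> (forall t, 0 <= t <= 1 -> f' t = 0) -> f 1 = f 0.
Proof.
move=> [C fC] f'0; apply/subr0_eq/eqP; rewrite -normr_eq0 eq_le normr_ge0 andbT.
apply/ler_addgt0Pl => e e0; rewrite addr0.
have C0 := dq_ge0 fC.
(* Each of the n pieces of [0, 1] contributes at most C / n^2, so n > C / e brings the total below
   e. *)
pose n := (Num.truncn (C / e)).+1.
have n0 : 0 < n%:R :> R by rewrite ltr0n.
have Cn : C / n%:R <= e.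
  by rewrite ler_pdivrMr// mulrC -ler_pdivrMr// ltW// truncnS_gt.
apply: le_trans Cn; pose u k := f (k%:R / n%:R).
have -> : f 1 - f 0 = u n - u 0%N by rewrite /u divff ?gt_eqF// mul0r.
rewrite -(telescope_sumr _ (leq0n n)) (le_trans (ler_norm_sum _ _ _))//.
rewrite (@le_trans _ _ (\sum_(0 <= i < n) C / n%:R ^+ 2))//; last first.
  by rewrite sumr_const_nat subn0 -[leLHS]mulr_natr expr2 invfM mulrA divfK// gt_eqF.
rewrite big_nat [leRHS]big_nat; apply: ler_sum => i /= ni.
have h j : (j <= n)%N -> 0 <= (j%:R / n%:R : R) <= 1.
  by move=> jn; rewrite divr_ge0//= ler_pdivrMr// mul1r ler_nat.
have [_ _] := fC _ _ (h i (ltnW ni)) (h i.+1 ni).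
rewrite f'0 ?h 1?ltnW// scaler0 subr0 -mulrBl -natrB// subSnn => /le_trans; apply.
by rewrite div1r exprVn.
Qed.

End NormedModule.

Section JordanProduct.
Context {V : jbAlgebraType R}.
Implicit Types (f g a b : R -> V).

Lemma dqM f f' g g' : dq f f' -> dq g g' ->
  dq (fun t => f t ** g t) (fun t => f' t ** g t + f t ** g' t).
Proof.
move=> [C fC] [D gD]; exists (4 * (C * D)) => s t s1 t1.
have C0 := dq_ge0 fC; have D0 := dq_ge0 gD.
have [f1 f2 f3] := fC s t s1 t1; have [g1 g2 g3] := gD s t s1 t1.
have [gt _ _] := gD t s t1 s1.
have CD0 : 0 <= C * D by rewrite mulr_ge0.
have M (x y : V) (c d : R) : `|x| <= c -> `|y| <= d -> `|x ** y| <= c * d.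
  by move=> xc yd; rewrite (le_trans (jnorm_mul _ _))// ler_pM.
split.
- by rewrite (le_trans (M _ _ _ _ f1 g1))// ler_peMl// ler1n.
- rewrite (le_trans (ler_normD _ _))// (le_trans (lerD (M _ _ _ _ f2 g1) (M _ _ _ _ f1 g2)))//.
  by lra.
pose h := t - s.
have h1 : `|h| <= 1 by rewrite /h ler_norml; lra.
have gts : `|g t - g s| <= 2 * D * `|h|.
  rewrite -(subrK (h *: g' s) (g t - g s)) (le_trans (ler_normD _ _))//.
  rewrite (_ : 2 * D * `|h| = D * `|h| + `|h| * D); last by ring.
  rewrite lerD// ?normrZ ?ler_wpM2l// (le_trans g3)// ler_wpM2l// -/h.
  by rewrite -(real_normK (num_real h)) expr2 ler_piMl.
(* The three terms are bounded by C D h^2, C D h^2 and 2 C D h^2, whence the constant 4. *)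
rewrite (_ : _ - _ = (f t - f s - h *: f' s) ** g t +
   f s ** (g t - g s - h *: g' s) + h *: (f' s ** (g t - g s))).
  rewrite (le_trans (ler_normD _ _))//.
  rewrite (_ : 4 * (C * D) * (t - s) ^+ 2 =
    (C * h ^+ 2 * D + C * (D * h ^+ 2)) + `|h| * (C * (2 * D * `|h|))); last first.
    by rewrite -/h -(real_normK (num_real h)); ring.
  rewrite lerD//.
    by rewrite (le_trans (ler_normD _ _))// lerD//; apply: M.
  by rewrite normrZ ler_wpM2l//; apply: M.
by rewrite !jbil -/h; lmod R.
Qed.

Lemma dqU a a' b b' : dq a a' -> dq b b' ->
  dq (fun t => U (a t) (b t))
     (fun t => 2 *: (a' t ** (a t ** b t) + a t ** (a' t ** b t)
                    - (a t ** a' t) ** b t) + U (a t) (b' t)).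
Proof.
move=> aa' bb'; have aab := dqM aa' (dqM aa' bb').
have := dqD (dqZ 2 aab) (dqN (dqM (dqM aa' aa') bb')).
apply: dq_ext => // t _; rewrite /U !jbil (jmulC (a' t) (a t)); lmod R.
Qed.

End JordanProduct.
End QuadraticIncrements.

(** * Power series in one element *)

Section PowerSeries.
Context {R : realType}.
Implicit Types (c : nat -> R) (q r s t : R).

(* The weight [n^2 + 1] controls the series together with its first two
   derivatives. *)
Definition summable2 c r := exists M, forall N,
  \sum_(0 <= n < N) `|c n| * (n%:R ^+ 2 + 1) * r ^+ n <= M.

(** Since n^2 + 1 <= 4^n, the exponential series at 4 r dominates. *)
Lemma summable2_exp r : 0 < r -> summable2 (fun n => n`!%:R^-1) r.
Proof.
move=> r0; exists (expR (4 * r)) => N.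
have le4 n : n%:R ^+ 2 + 1 <= 4 ^+ n :> R.
  elim: n => [|n IHn]; first by rewrite expr0n/= add0r expr0.
  rewrite -natr1 [leRHS]exprS; have : 0 <= (n%:R : R) by [].
  move: IHn; move: (n%:R : R) (4 ^+ n) => a b ab a0.
  have h1 := sqr_ge0 (a - 1); have h2 := sqr_ge0 a; nra.
apply: (@le_trans _ _ (series (exp_coeff (4 * r)) N)).
  rewrite /series/= ler_sum// => n _; rewrite /exp_coeff/= ger0_norm ?invr_ge0//.
  rewrite exprMn -[leRHS]mulrA [X in X * _]mulrC -[leLHS]mulrA [X in _ * X]mulrC.
  by rewrite ler_wpM2r// divr_ge0// exprn_ge0// ltW.
apply: nondecreasing_cvgn_le; last exact: is_cvg_series_exp_coeff.
by apply: nondecreasing_series => n _ _; rewrite exp_coeff_ge0// mulr_ge0// ltW.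
Qed.

Lemma geometric_sum_le q n : 0 <= q < 1 -> \sum_(0 <= i < n) q ^+ i <= (1 - q)^-1.
Proof.
move=> /andP[q0 q1]; have q1' : 0 < 1 - q by rewrite subr_gt0.
rewrite -div1r ler_pdivlMr// mulrC.
suff -> : (1 - q) * \sum_(0 <= i < n) q ^+ i = 1 - q ^+ n.
  by rewrite gerBl exprn_ge0.
elim: n => [|n IHn]; first by rewrite big_nil expr0 subrr mulr0.
by rewrite big_nat_recr//= mulrDr IHn exprS; ring.
Qed.

Lemma summable2_geometric c r : 0 < r < 1 -> (forall n, `|c n| <= 1) ->
  summable2 c r.
Proof.
(* Chosen so that r <= q^3: two factors q^n absorb the weight through (n + 1) q^n <= 1 / (1 - q),
   and the third leaves a geometric series. *)
move=> /andP[r0 r1] c1; pose q := 1 - (1 - r) / 3.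
have q01 : 0 <= q < 1 by rewrite /q; lra.
have /andP[q0 q1] := q01.
have rq : r <= q ^+ 3.
  have h : 0 <= (1 - q) ^+ 2 * (2 + q) by rewrite mulr_ge0 ?sqr_ge0//; lra.
  have -> : r = q ^+ 3 - (1 - q) ^+ 2 * (2 + q) by rewrite /q; field.
  by rewrite gerBl.
pose K := (1 - q)^-1.
have K0 : 0 < K by rewrite invr_gt0 subr_gt0.
have nq n : n.+1%:R * q ^+ n <= K.
  apply: le_trans (geometric_sum_le n.+1 q01).
  rewrite mulr_natl -[n.+1 in X in X <= _]subn0 -sumr_const_nat.
  rewrite big_nat [leRHS]big_nat; apply: ler_sum => i; rewrite ltnS => /andP[_ ni].
  by rewrite ler_wiXn2l// ltW.
exists (K ^+ 2 * K) => N.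
apply: (@le_trans _ _ (\sum_(0 <= n < N) K ^+ 2 * q ^+ n)).
  apply: ler_sum => n _.
  have A0 : 0 <= (n%:R ^+ 2 + 1 : R) by rewrite addr_ge0.
  apply: (@le_trans _ _ ((n.+1%:R * q ^+ n) ^+ 2 * q ^+ n)); last first.
    by rewrite ler_wpM2r ?exprn_ge0// lerXn2r ?nnegrE ?(ltW K0)// mulr_ge0// exprn_ge0.
  rewrite (_ : _ ^+ 2 * _ = n.+1%:R ^+ 2 * (q ^+ 3) ^+ n); last first.
    by rewrite exprMn -[LHS]mulrA; congr (_ * _); rewrite -!exprM -exprD -mulnSr mulnC.
  apply: ler_pM; [exact: mulr_ge0|by rewrite exprn_ge0// ltW| |].
    rewrite (@le_trans _ _ (n%:R ^+ 2 + 1))// ?ler_piMl// -natr1.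
    by have : 0 <= (n%:R : R) by []; nra.
  by rewrite lerXn2r// nnegrE ?exprn_ge0// ltW.
by rewrite -big_distrr/= ler_wpM2l ?sqr_ge0//; exact: geometric_sum_le.
Qed.

Lemma exprn_increment s t n : 0 <= s <= 1 -> 0 <= t <= 1 ->
  `|t ^+ n - s ^+ n - (t - s) * (n%:R * s ^+ n.-1)| <= n%:R ^+ 2 * (t - s) ^+ 2.
Proof.
move=> s1 t1; have h0 : 0 <= (t - s) ^+ 2 by rewrite sqr_ge0.
elim: n => [|n IHn]; first by rewrite !expr0 mul0r mulr0 !subrr normr0 expr0n/= mul0r.
rewrite (_ : _ - _ = t * (t ^+ n - s ^+ n - (t - s) * (n%:R * s ^+ n.-1)) +
                     n%:R * s ^+ n.-1 * (t - s) ^+ 2); last first.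
  by case: n {IHn} => [|n] /=; rewrite ?exprS -?natr1 ?expr0; ring.
rewrite (le_trans (ler_normD _ _))//.
apply: (@le_trans _ _ (n%:R ^+ 2 * (t - s) ^+ 2 + n%:R * (t - s) ^+ 2)); last first.
  by rewrite -natr1; have : 0 <= (n%:R : R) by []; nra.
rewrite lerD//.
  rewrite normrM (le_trans _ IHn)// ler_piMl//; have /andP[t0 t1'] := t1.
  by rewrite ger0_norm.
rewrite normrM (ger0_norm h0) ler_wpM2r// normrM ger0_norm// ler_piMr//.
have /andP[s0 s1'] := s1.
by rewrite ger0_norm ?exprn_ge0// exprn_ile1.
Qed.

Context {V : jbAlgebraType R}.
Implicit Types (x y : V).

(** Only an upper bound, since V may be the zero algebra. *)
Lemma norm_jone : `|\e : V| <= 1.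
Proof.
have := jnorm_sqr (\e : V); rewrite jmul1x => e1; rewrite leNgt; apply/negP => e2.
by move: e1; nra.
Qed.

Lemma jpowS x n : jpow x n.+1 = x ** jpow x n.
Proof. by []. Qed.

Lemma jpow_norm x n : `|jpow x n| <= `|x| ^+ n.
Proof.
elim: n => [|n IHn]; first by rewrite expr0 norm_jone.
by rewrite jpowS exprS (le_trans (jnorm_mul _ _))// ler_wpM2l.
Qed.

Lemma jpowZ t x n : jpow (t *: x) n = t ^+ n *: jpow x n.
Proof.
elim: n => [|n IHn]; first by rewrite expr0 scale1r.
by rewrite !jpowS IHn !jbil scalerA -exprSr.
Qed.

Lemma jpow_alg x n : alg x (jpow x n).
Proof. by elim: n => [|n IHn]; [exact: alg1|exact: algl]. Qed.

(** The factor r on the left replaces an exponent n - 1 on the right. *)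
Lemma jpow_lipschitz x y r n : `|x| <= r -> `|y| <= r ->
  r * `|jpow x n - jpow y n| <= n%:R * r ^+ n * `|x - y|.
Proof.
move=> xr yr; have r0 : 0 <= r by exact: le_trans xr.
elim: n => [|n IHn]; first by rewrite subrr normr0 mulr0 !mul0r.
rewrite !jpowS (_ : _ - _ = (x - y) ** jpow x n + y ** (jpow x n - jpow y n)).
  rewrite (@le_trans _ _ (r * (`|x - y| * r ^+ n) + r * (`|jpow x n - jpow y n| * r)))//.
    rewrite -mulrDr ler_wpM2l// (le_trans (ler_normD _ _))// lerD//.
      rewrite (le_trans (jnorm_mul _ _))// ler_wpM2l//.
      by rewrite (le_trans (jpow_norm _ _))// lerXn2r ?nnegrE.
    by rewrite (le_trans (jnorm_mul _ _))// mulrC ler_wpM2l.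
  rewrite exprS -natr1 mulrA.
  have := ler_wpM2r r0 IHn; lra.
by rewrite !jbil; lmod R.
Qed.

Definition psterm c x n := c n *: jpow x n.

Definition psum c x : V := limn (series (psterm c x)).

Lemma jexpE x : jexp x = psum (fun n => n`!%:R^-1) x.
Proof. by []. Qed.

Lemma psum_cvg c r x : summable2 c r -> `|x| <= r ->
  series (psterm c x) @ \oo --> psum c x.
Proof.
move=> [M cM] xr; suff: cvgn (series (psterm c x)) by [].
apply: normed_cvg; apply: nondecreasing_is_cvgn.
  by apply: nondecreasing_series => n _ _ /=.
exists M => _ [N _ <-]; apply: le_trans (cM N); apply: ler_sum => n _.
rewrite /= /psterm normrZ -mulrA ler_wpM2l//.
rewrite (@le_trans _ _ (r ^+ n))//.
  by rewrite (le_trans (jpow_norm _ _))// lerXn2r ?nnegrE// (le_trans _ xr).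
have r0 : 0 <= r ^+ n by rewrite exprn_ge0// (le_trans _ xr).
by rewrite mulrDl mul1r lerDr mulr_ge0// sqr_ge0.
Qed.

Lemma cvgn_norm_le (u : nat -> V) (l : V) (K : R) : u @ \oo --> l ->
  (forall n, `|u n| <= K) -> `|l| <= K.
Proof.
move=> ul uK; apply: (closed_cvg (fun y : R => y <= K) _ _ _ (cvg_norm ul)).
  exact: closed_le.
exact: nearW.
Qed.

Lemma psum_bounded c r : 0 < r -> summable2 c r ->
  exists K, forall x, `|x| <= r -> `|psum c x| <= K.
Proof.
move=> r0 cr; have [M cM] := cr; exists M => x xr.
apply: cvgn_norm_le (psum_cvg cr xr) _ => N; apply: le_trans (cM N).
rewrite (le_trans (ler_norm_sum _ _ _))//; apply: ler_sum => n _.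
rewrite /psterm normrZ -mulrA ler_wpM2l//.
rewrite (@le_trans _ _ (r ^+ n))//.
  by rewrite (le_trans (jpow_norm _ _))// lerXn2r ?nnegrE// ltW.
by rewrite mulrDl mul1r lerDr mulr_ge0 ?sqr_ge0// exprn_ge0// ltW.
Qed.

Lemma psum_lipschitz c r : 0 < r -> summable2 c r ->
  exists K, forall x y, `|x| <= r -> `|y| <= r ->
    `|psum c x - psum c y| <= K * `|x - y|.
Proof.
move=> r0 cr; have [M cM] := cr; exists (M / r) => x y xr yr.
apply: cvgn_norm_le (cvgB (psum_cvg cr xr) (psum_cvg cr yr)) _ => N.
rewrite mulrAC ler_pdivlMr//.
apply: (@le_trans _ _ ((\sum_(0 <= n < N) `|c n| * (n%:R ^+ 2 + 1) * r ^+ n) * `|x - y|)).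
  rewrite fctE /series/= -sumrB mulrC (le_trans (ler_wpM2l (ltW r0) (ler_norm_sum _ _ _)))//.
  rewrite mulr_sumr mulr_suml; apply: ler_sum => n _.
  rewrite /psterm -scalerBr normrZ mulrCA -!mulrA ler_wpM2l//.
  have nn : n%:R <= n%:R ^+ 2 + 1 :> R.
    by move: (n%:R : R) (ler0n R n) => a a0; nra.
  apply: le_trans (jpow_lipschitz n xr yr) _.
  rewrite -[leLHS]mulrA; apply: ler_wpM2r => //.
  by rewrite mulr_ge0// exprn_ge0// ltW.
by rewrite ler_wpM2r.
Qed.

Lemma psum_continuous c r x : `|x| < r -> summable2 c r ->
  {for x, continuous (psum c : V -> V)}.
Proof.
move=> xr cr; have r0 : 0 < r by apply: le_lt_trans xr.
have [K cK] := psum_lipschitz r0 cr.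
apply: (@lipschitz_near_continuous _ _ _ _ x K (r - `|x|)); rewrite ?subr_gt0//.
move=> y yx; apply: cK; first exact: ltW.
by rewrite -(subrK x y) (le_trans (ler_normD _ _))// distrC -lerBrDr.
Qed.

Lemma psum_alg c r x : `|x| <= r -> summable2 c r -> alg x (psum c x).
Proof.
move=> xr cr; apply: (@closed_cvg _ _ \oo _ (series (psterm c x)) (alg x)).
- exact: (alg_subspace x).1.
- apply: nearW => n; rewrite /series/=; elim/big_ind: _ => //.
  + exact: alg0.
  + by move=> u v; exact: algD.
  + by move=> i _; apply/algZ/jpow_alg.
- exact: psum_cvg cr xr.
Qed.

Lemma psum_dq c d r x : 0 < r -> `|x| <= r -> summable2 c r -> summable2 d r ->
  (forall n, d n = n.+1%:R * c n.+1) ->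
  dq (fun t => psum c (t *: x)) (fun t => x ** psum d (t *: x)).
Proof.
move=> r0 xr cr dr dE; have [M cM] := cr.
have [K cK] := psum_bounded r0 cr; have [L dL] := psum_bounded r0 dr.
have txr t : 0 <= t <= 1 -> `|t *: x| <= r.
  move=> /andP[t0 t1]; rewrite normrZ ger0_norm// (le_trans _ xr)//.
  by rewrite ler_piMl.
have K0 : 0 <= K by apply: le_trans (cK 0 _); rewrite ?normr0// ltW.
have L0 : 0 <= L by apply: le_trans (dL 0 _); rewrite ?normr0// ltW.
have M0 : 0 <= M by have := cM 0%N; rewrite big_nil.
have rL0 : 0 <= r * L by rewrite mulr_ge0// ltW.
exists (K + r * L + M) => s t s1 t1; split.
- by rewrite (le_trans (cK _ (txr _ s1)))//; lra.
- rewrite (le_trans (jnorm_mul _ _))// (@le_trans _ _ (r * L))//; last by lra.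
  by rewrite ler_pM// dL// txr.
have h0 : 0 <= (t - s) ^+ 2 by rewrite sqr_ge0.
apply: (@le_trans _ _ (M * (t - s) ^+ 2)); last by rewrite ler_wpM2r//; lra.
(* The sums of c run one term further, because multiplying the derived series by x raises each
   degree by one. *)
have ct : series (psterm c (t *: x)) n.+1 @[n --> \oo] --> psum c (t *: x).
  by rewrite (cvg_shiftS _ _); exact: psum_cvg cr (txr _ t1).
have cs : series (psterm c (s *: x)) n.+1 @[n --> \oo] --> psum c (s *: x).
  by rewrite (cvg_shiftS _ _); exact: psum_cvg cr (txr _ s1).
have ds : x ** series (psterm d (s *: x)) n @[n --> \oo] --> x ** psum d (s *: x).
  apply: continuous_cvg; first exact: jmul_continuous.
  exact: psum_cvg dr (txr _ s1).
have lim := cvgB (cvgB ct cs) (cvgZ (cvg_cst (t - s)) ds).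
apply: (cvgn_norm_le (lim _ _ _ _)) => N; rewrite !fctE.
have -> : x ** series (psterm d (s *: x)) N =
    \sum_(0 <= n < N.+1) (c n * (n%:R * s ^+ n.-1)) *: jpow x n.
  rewrite big_nat_recl// mul0r mulr0 scale0r add0r /series/=.
  rewrite (big_morph (jmul x) (jmulDr x) (jmul0r x)); apply: eq_bigr => n _.
  by rewrite /psterm jpowZ !jbil scalerA dE; congr (_ *: _); rewrite /=; ring.
rewrite /series/= scaler_sumr -!sumrB.
rewrite (le_trans (ler_norm_sum _ _ _))// (le_trans _ (ler_wpM2r h0 (cM N.+1)))//.
rewrite mulr_suml; apply: ler_sum => n _; rewrite /psterm !jpowZ.
rewrite (_ : _ - _ = (c n * (t ^+ n - s ^+ n - (t - s) * (n%:R * s ^+ n.-1))) *: jpow x n).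
  rewrite normrZ normrM.
  rewrite [leRHS](_ : _ = `|c n| * ((n%:R ^+ 2 + 1) * (t - s) ^+ 2) * r ^+ n); last by ring.
  apply: ler_pM; rewrite ?mulr_ge0//.
    rewrite ler_wpM2l// (le_trans (exprn_increment _ s1 t1))// ler_wpM2r//.
    by rewrite lerDl.
  by rewrite (le_trans (jpow_norm _ _))// lerXn2r ?nnegrE// ltW.
lmod R.
Qed.

End PowerSeries.

(** * The exponential and the fundamental formula *)

Section Exponential.
Context {R : realType} {V : jbAlgebraType R}.
Implicit Types (a b u v w x y z : V) (r s t : R).

Lemma cvgn_eq (f g : nat -> V) (l m : V) : f @ \oo --> l -> g @ \oo --> m ->
  f = g -> l = m.
Proof.
by move=> fl gm fg; apply: (cvg_unique (@norm_hausdorff _ V) fl); rewrite fg.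
Qed.

Lemma psum_shift (c : nat -> R) r x : summable2 c r -> `|x| <= r ->
  series (psterm c x) n.+1 @[n --> \oo] --> psum c x.
Proof. by move=> cr xr; rewrite (cvg_shiftS _ _); exact: psum_cvg cr xr. Qed.

Lemma psum0 (c : nat -> R) : psum c 0 = c 0%N *: \e :> V.
Proof.
apply: norm_lim_near_cst; exists 1%N => // -[//|n] _.
rewrite /series/= big_nat_recl// big1 ?addr0// => i _.
by rewrite /psterm jpowS jmul0l scaler0.
Qed.

Lemma jexp0 : jexp (0 : V) = \e.
Proof. by rewrite jexpE psum0 fact0 invr1 scale1r. Qed.

Lemma jexp_alg a u : alg a u -> alg a (jexp u).
Proof.
move=> au; apply: (alg_trans au); rewrite jexpE.
have u0 : 0 < `|u| + 1 by rewrite ltr_wpDl.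
by apply: psum_alg (summable2_exp u0); rewrite lerDl.
Qed.

Lemma jexp_continuous : continuous (@jexp R V).
Proof.
move=> u; have u0 : 0 < `|u| + 1 by rewrite ltr_wpDl.
by apply: psum_continuous (summable2_exp u0); rewrite ltrDl.
Qed.

Lemma dq_exp u : dq (fun t => jexp (t *: u)) (fun t => u ** jexp (t *: u)).
Proof.
have u0 : 0 < `|u| + 1 by rewrite ltr_wpDl.
apply: (psum_dq u0 _ (summable2_exp u0) (summable2_exp u0)); first by rewrite lerDl.
by move=> n; rewrite factS natrM invfM mulrA divff ?mul1r// pnatr_eq0.
Qed.

Lemma jexp_alg_scale a u t : alg a u -> alg a (jexp (t *: u)).
Proof. by move=> au; apply/jexp_alg/algZ. Qed.

(** The product of the exponentials of t u, t v and - t (u + v) has zero derivative. The case v = 0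
    gives inverses, and the two together give the addition formula. *)
Let jexp3 a u v : alg a u -> alg a v ->
  jexp u ** (jexp v ** jexp (- (u + v))) = \e.
Proof.
move=> au av; have auv : alg a (- (u + v)) by apply/algN/algD.
have := dq_const (dqM (dq_exp u) (dqM (dq_exp v) (dq_exp (- (u + v))))).
rewrite !scale1r !scale0r jexp0 !jmul1x; apply => t _.
set A := jexp (t *: u); set B := jexp (t *: v); set C := jexp _.
have [aA aB aC] : [/\ alg a A, alg a B & alg a C] by split; exact: jexp_alg_scale.
rewrite (algA _ au (algM aB aC)) (algA _ av aC) !jbil.
rewrite (algCA _ aB au) (algCA _ aB av) (algCA _ aA au) (algCA _ aA av).
lmod R.
Qed.

Lemma jexpNr u : jexp u ** jexp (- u) = \e.
Proof.
by have := jexp3 (alg_id u) (alg0 u); rewrite jexp0 addr0 jmul1x.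
Qed.

Lemma jexpD a u v : alg a u -> alg a v -> jexp (u + v) = jexp u ** jexp v.
Proof.
move=> au av; have := jexp3 au av; set w := u + v => E.
have aw : alg a w by exact: algD.
rewrite -[LHS]jmulx1 -E.
rewrite (algCA _ (jexp_alg aw) (jexp_alg au)) (algCA _ (jexp_alg aw) (jexp_alg av)).
by rewrite jexpNr jmulx1.
Qed.

Lemma jexp_half_sqr u : jexp (2^-1 *: u) ** jexp (2^-1 *: u) = jexp u.
Proof.
rewrite -(jexpD (algZ _ (alg_id u)) (algZ _ (alg_id u))); congr jexp; lmod R.
Qed.

Lemma jexp_double u : jexp u ** jexp u = jexp (2 *: u).
Proof. by rewrite -(jexpD (alg_id u) (alg_id u)); congr jexp; lmod R. Qed.

Lemma jexp_scalar (c : R) : jexp (c *: \e) = expR c *: \e :> V.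
Proof.
have jpow1 n : jpow (\e : V) n = \e by elim: n => // n IHn; rewrite jpowS IHn jmul1x.
have c0 : 0 < `|c *: \e : V| + 1 by rewrite ltr_wpDl.
apply: cvgn_eq (psum_cvg (summable2_exp c0) _) (cvgZ _ (cvg_cst \e)) _.
- by rewrite lerDl.
- exact: (@is_cvg_series_exp_coeff R c).
apply/funext => n; rewrite /series/= scaler_suml; apply: eq_bigr => i _.
by rewrite /psterm jpowZ jpow1 scalerA mulrC.
Qed.

Lemma jexp_quadratic r : 0 < r -> exists K, forall u, `|u| <= r ->
  `|jexp u - \e - u| <= K * `|u| ^+ 2.
Proof.
move=> r0; have er := summable2_exp r0; have [M eM] := er.
exists (M / r ^+ 2) => u ur.
have h : series (psterm (fun n => n`!%:R^-1) u) n.+2 @[n --> \oo] --> jexp u.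
  rewrite (@cvg_shiftS _ (fun n => series (psterm (fun n => n`!%:R^-1) u) n.+1)).
  exact: psum_shift er ur.
have lim := cvgB (cvgB h (cvg_cst \e)) (cvg_cst u).
apply: (cvgn_norm_le (lim _ _ _ _)) => N; rewrite !fctE /series/=.
rewrite 2?big_nat_recl//.
have -> : psterm (fun n => n`!%:R^-1) u 0 = \e by rewrite /psterm invr1 scale1r.
have -> : psterm (fun n => n`!%:R^-1) u 1 = u.
  by rewrite /psterm invr1 scale1r jpowS jmulx1.
rewrite (_ : _ - _ = \sum_(0 <= i < N) psterm (fun n => n`!%:R^-1) u i.+2);
  last by rewrite (addrC \e) addrK (addrC u) addrK.
rewrite mulrAC ler_pdivlMr ?exprn_gt0// mulrC.
apply: (@le_trans _ _ ((\sum_(0 <= n < N.+2) `|n`!%:R^-1| * (n%:R ^+ 2 + 1) * r ^+ n) * `|u| ^+ 2)); last first.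
  by rewrite ler_wpM2r ?sqr_ge0.
rewrite 2?big_nat_recl//.
rewrite (le_trans (ler_wpM2l _ (ler_norm_sum _ _ _))) ?sqr_ge0//.
rewrite addrA mulrDl ler_wpDl//.
  by rewrite mulr_ge0 ?sqr_ge0// addr_ge0// !mulr_ge0 ?addr_ge0// exprn_ge0// ltW.
rewrite mulr_sumr mulr_suml; apply: ler_sum => n _.
rewrite /psterm normrZ mulrCA -[leRHS]mulrA -[leRHS]mulrA ler_wpM2l//.
apply: (@le_trans _ _ (r ^+ n.+2 * `|u| ^+ 2)); last first.
  apply: ler_peMl; last by rewrite lerDr sqr_ge0.
  by rewrite mulr_ge0 ?sqr_ge0// exprn_ge0// ltW.
apply: (@le_trans _ _ (r ^+ 2 * `|u| ^+ n.+2)).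
  by rewrite ler_wpM2l ?sqr_ge0//; exact: jpow_norm.
rewrite [leLHS](_ : _ = (r ^+ 2 * `|u| ^+ 2) * `|u| ^+ n); last by rewrite -[n.+2]addn2 exprD; ring.
rewrite [leRHS](_ : _ = (r ^+ 2 * `|u| ^+ 2) * r ^+ n); last by rewrite -[n.+2]addn2 exprD; ring.
apply: ler_wpM2l; first by rewrite mulr_ge0// sqr_ge0.
by apply: lerXn2r; rewrite ?nnegrE// ltW.
Qed.

(** If d were nonzero, all the vectors 2^-n d would have exponential 1, which contradicts |exp u - 1
    - u| <= K |u|^2 for large n. *)
Lemma jexp_eq1 (d : V) : jexp d = \e -> d = 0.
Proof.
(* With p = exp (h / 2) and q^2 = p, the squares of p - 1 and (p - 1) q add up to (p - 1) (p^2 - 1)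
   = 0, so the norm axiom forces p = 1. *)
have half (h : V) : jexp h = \e -> jexp (2^-1 *: h) = \e.
  move=> h1; set p := jexp (2^-1 *: h); set q := jexp (2^-1 *: (2^-1 *: h)).
  have pp : p ** p = \e by rewrite /p jexp_half_sqr.
  have qq : q ** q = p by exact: jexp_half_sqr.
  have aq : alg h q by apply/jexp_alg/algZ/algZ/alg_id.
  have ap : alg h p by apply/jexp_alg/algZ/alg_id.
  pose k := (p - \e) ** q.
  have ak : alg h (p - \e) by apply: algB => //; exact: alg1.
  have kk : k ** k = (p - \e) ** ((p - \e) ** p).
    by rewrite /k (algA _ ak (algM ak aq)) (algCA _ aq ak) qq.
  have E0 : (p - \e) ** (p - \e) + k ** k = 0.
    by rewrite kk !jbil !jmul1x !jmulx1 !pp !jmulx1; lmod R.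
  have := jnorm_sqrD (p - \e) k; rewrite E0 normr0.
  rewrite jnorm_sqr => h2; apply/subr0_eq/eqP; rewrite -normr_eq0 -sqrf_eq0.
  by rewrite eq_le h2 sqr_ge0.
move=> d1; have dn n : jexp (2^-1 ^+ n *: d) = \e.
  elim: n => [|n IHn]; first by rewrite scale1r.
  by rewrite exprS -scalerA half.
have [K eK] := jexp_quadratic (ltr_pwDr ltr01 (normr_ge0 d)).
apply/eqP; rewrite -normr_eq0 eq_le normr_ge0 andbT leNgt; apply/negP => d0.
have [n nK] : exists n, `|K| * (2^-1 ^+ n * `|d|) < 1.
  have /cvgrPdist_lt/(_ (`|K| * `|d| + 1)^-1) :
      (2^-1 : R) ^+ n @[n --> \oo] --> 0.
    by apply: cvg_expr; rewrite gtr0_norm; lra.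
  have Kd : 0 < `|K| * `|d| + 1 by rewrite ltr_wpDl// mulr_ge0.
  rewrite invr_gt0 => /(_ Kd)[n _ /(_ n (leqnn n))]/=.
  rewrite sub0r normrN ger0_norm ?exprn_ge0// => h; exists n.
  move: h; rewrite -[ltRHS]div1r ltr_pdivlMr//; set q := _ ^+ n.
  have : 0 <= q by rewrite exprn_ge0.
  by nra.
have q0 : 0 < 2^-1 ^+ n :> R by rewrite exprn_gt0.
have := eK (2^-1 ^+ n *: d); rewrite dn subrr sub0r normrN normrZ (gtr0_norm q0).
set q := _ ^+ n in q0 nK *.
have q1 : q <= 1 by rewrite exprn_ile1//; lra.
have qd : 0 < q * `|d| by rewrite mulr_gt0.
have -> : q * `|d| <= `|d| + 1 by nra.
move=> /(_ isT); rewrite leNgt => /negP; apply.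
rewrite expr2 mulrA -[ltRHS]mul1r ltr_pM2r//.
by apply: le_lt_trans nK; rewrite ler_wpM2r ?ler_norm// ltW.
Qed.

Lemma jexp_inj_alg a u v : alg a u -> alg a v -> jexp u = jexp v -> u = v.
Proof.
move=> au av E; apply/subr0_eq/jexp_eq1.
by rewrite (jexpD au (algN av)) E jexpNr.
Qed.

Lemma U_alg_comm a x y z : alg a x -> alg a z -> z ** U x y = U x (z ** y).
Proof.
move=> ax az; rewrite /U !jbil.
by rewrite !(algCA _ az ax) (algCA _ az (algM ax ax)).
Qed.

Lemma UZr x c y : U x (c *: y) = c *: U x y.
Proof. by rewrite /U !jbil; lmod R. Qed.

Lemma UNr x y : U x (- y) = - U x y.
Proof. by rewrite /U !jbil; lmod R. Qed.

Lemma UDr x y z : U x (y + z) = U x y + U x z.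
Proof. by rewrite /U !jbil; lmod R. Qed.

Lemma U1l y : U \e y = y.
Proof. by rewrite /U !jmul1x; lmod R. Qed.

Lemma Ux1 x : U x \e = x ** x.
Proof. by rewrite /U !jmulx1; lmod R. Qed.

Lemma U0r x : U x 0 = 0.
Proof. by rewrite -(scale0r 0) UZr !scale0r. Qed.

Lemma dq_Uexp u (b b' : R -> V) : dq b b' ->
  dq (fun t => U (jexp (t *: u)) (b t))
     (fun t => 2 *: (u ** U (jexp (t *: u)) (b t)) + U (jexp (t *: u)) (b' t)).
Proof.
move=> bb'; have := dqU (dq_exp u) bb'; apply: dq_ext => // t _.
have au := alg_id u; have ae := jexp_alg_scale t au.
by rewrite U_deriv_comm//; apply: (@alg_opcomm _ _ u) => //; exact: algM.
Qed.

Lemma U_expK u y : U (jexp u) (U (jexp (- u)) y) = y.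
Proof.
have := dq_const (dq_Uexp u (dq_Uexp (- u) (dq_cst y))).
rewrite !scale1r !scale0r jexp0 !U1l; apply => t _.
have au := alg_id u; have ae := jexp_alg_scale t au.
rewrite U0r addr0 UZr jmulNl UNr -(U_alg_comm _ ae au); lmod R.
Qed.

Lemma U_expKV u y : U (jexp (- u)) (U (jexp u) y) = y.
Proof. by have := U_expK (- u) y; rewrite opprK. Qed.

(* The fundamental formula for [jexp x], by differentiating
   [t |-> U_{exp(-tx)} U_{U_{exp(tx)} y} U_{exp(-tx)} v]. *)
Lemma U_fundamental x y v :
  U (U (jexp x) y) v = U (jexp x) (U y (U (jexp x) v)).
Proof.
suff H w : U (jexp (- x)) (U (U (jexp x) y) (U (jexp (- x)) w)) = U y w.
  by rewrite -H U_expK U_expKV.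
have := dq_const (dq_Uexp (- x)
  (dqU (dq_Uexp x (dq_cst y)) (dq_Uexp (- x) (dq_cst w)))).
rewrite !scale1r !scale0r jexp0 !U1l; apply => t _.
set b := U (jexp (t *: - x)) w; set z := U (jexp (t *: x)) y.
rewrite !U0r !addr0; move: (z) (b) => {}z {}b.
have aNx : alg x (- x) by apply/algN/alg_id.
(* By [U_deriv], the derivative of z contributes a term U_z (x b), which the derivative of b
   cancels, as b moves along - x. *)
set E := (X in _ + U _ X); have -> : E = 2 *: (x ** U z b).
  rewrite /E !(jmulZl, jmulZr, jmulNl, jmulNr) UZr UNr.
  by apply: (@lin_comb1 R V _ _ _ _ 2 (U_deriv x z b)); lmod R.
rewrite jmulNl (U_alg_comm _ (jexp_alg_scale t aNx) (alg_id x)) UZr; lmod R.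
Qed.

End Exponential.

(** * The logarithm near the unit *)

Section Logarithm.
Context {R : realType} {V : jbAlgebraType R}.
Implicit Types (a b u v w x y z : V) (c r s t : R).

Lemma dq_id a : dq (fun t => t *: a) (fun=> a).
Proof.
exists `|a| => s t /andP[s0 s1] _; split => //.
  by rewrite normrZ ger0_norm// ler_piMl.
by rewrite -scalerBl subrr normr0 mulr_ge0// sqr_ge0.
Qed.

(** Chain rule for paths in one subalgebra, where the addition formula reduces it to the expansion
    of exp at 0. *)
Lemma dq_exp_comp a (m m' : R -> V) : dq m m' ->
  (forall t, 0 <= t <= 1 -> alg a (m t)) ->
  (forall t, 0 <= t <= 1 -> alg a (m' t)) ->
  dq (fun t => jexp (m t)) (fun t => m' t ** jexp (m t)).
Proof.
move=> [C mC] am am'; have C0 := dq_ge0 mC.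
have C1 : 0 < C + 1 by rewrite ltr_wpDl.
have [E eE] := psum_bounded (V := V) C1 (summable2_exp C1).
have C2 : 0 < 2 * C + 1 by lra.
have [K eK] := jexp_quadratic (V := V) C2.
have E0 : 0 <= E by apply: le_trans (eE 0 _); rewrite ?normr0// ltW.
have KE : 0 <= `|K| * (4 * C ^+ 2) * E by rewrite !mulr_ge0// sqr_ge0.
exists (E + C * E + `|K| * (4 * C ^+ 2) * E) => s t s1 t1.
have CE : 0 <= C * E by rewrite mulr_ge0.
have [m1 m2 m3] := mC s t s1 t1.
have em : `|jexp (m s)| <= E by apply: eE; rewrite (le_trans m1)// lerDl.
split; first by lra.
  rewrite (le_trans (jnorm_mul _ _))// (@le_trans _ _ (C * E))//; last by lra.
  exact: ler_pM.
set h := t - s; set d := m t - m s.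
have h1 : `|h| <= 1 by rewrite /h ler_norml; lra.
have dh : `|d| <= 2 * C * `|h|.
  rewrite /d -(subrK (h *: m' s) (m t - m s)) (le_trans (ler_normD _ _))//.
  rewrite (_ : 2 * C * `|h| = C * `|h| + `|h| * C); last by ring.
  rewrite lerD// ?normrZ ?ler_wpM2l// (le_trans m3)// ler_wpM2l// -/h.
  by rewrite -(real_normK (num_real h)) expr2 ler_piMl.
have d1 : `|d| <= 2 * C + 1.
  rewrite (le_trans dh)// (@le_trans _ _ (2 * C)) ?lerDl//.
  by rewrite ler_piMr// mulr_ge0.
have ad : alg a d by apply: algB; exact: am.
rewrite (_ : jexp (m t) - _ - _ =
   jexp (m s) ** (jexp d - \e - d) + jexp (m s) ** (d - h *: m' s)); last first.
  have -> : m t = m s + d by rewrite addrC subrK.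
  rewrite (jexpD (am s s1) ad) !jbil jmulx1 (jmulC (m' s)); lmod R.
rewrite (le_trans (ler_normD _ _))//.
apply: (@le_trans _ _ (E * (`|K| * (4 * C ^+ 2) * h ^+ 2) + E * (C * h ^+ 2))); last first.
  have : 0 <= E * h ^+ 2 by rewrite mulr_ge0// sqr_ge0.
  by lra.
rewrite lerD// (le_trans (jnorm_mul _ _))// ler_pM//.
rewrite (le_trans (eK _ d1))// (@le_trans _ _ (`|K| * `|d| ^+ 2))//.
  by rewrite ler_wpM2r ?sqr_ge0// ler_norm.
rewrite -[leRHS]mulrA ler_wpM2l//.
rewrite (_ : 4 * C ^+ 2 * h ^+ 2 = (2 * C * `|h|) ^+ 2).
  by apply: lerXn2r dh; rewrite nnegrE ?normr_ge0// !mulr_ge0.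
by rewrite -(real_normK (num_real h)); ring.
Qed.

(* [lser a] is the power series of [ln (1 - a)]; its constant coefficient
   [- 0^-1] is [0]. *)
Definition lser a : V := psum (fun n => - n%:R^-1) a.

Lemma summable2_lser r : 0 < r < 1 -> summable2 (fun n => - n%:R^-1) r.
Proof.
move=> r01; apply: summable2_geometric r01 _ => -[|n].
  by rewrite invr0 oppr0 normr0.
by rewrite normrN ger0_norm ?invr_ge0// invf_le1 ?ltr0n// ler1n.
Qed.

Lemma lser_alg a : `|a| < 1 -> alg a (lser a).
Proof.
move=> a1; have a0 := normr_ge0 a.
have r01 : 0 < (`|a| + 1) / 2 < 1 by lra.
by apply: psum_alg (summable2_lser r01); lra.
Qed.

(** The sum is - (1 - x)^-1, handled through its fixed-point equation. *)
Lemma geometric_psum x : `|x| < 1 ->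
  psum (fun=> -1) x = - \e + x ** psum (fun=> -1) x.
Proof.
move=> x1; have x0 := normr_ge0 x.
have r01 : 0 < (`|x| + 1) / 2 < 1 by lra.
have xr : `|x| <= (`|x| + 1) / 2 by lra.
have gr : summable2 (fun=> -1) ((`|x| + 1) / 2).
  by apply: summable2_geometric r01 _ => n; rewrite normrN1.
apply: cvgn_eq (psum_shift gr xr) (cvgD (cvg_cst _)
  (cvg_jmul _ (cvg_cst x) (psum_cvg gr xr))) _.
apply/funext => n; rewrite !fctE /series/= big_nat_recl//.
rewrite /psterm scaleN1r; congr (_ + _).
by rewrite (big_morph (jmul x) (jmulDr x) (jmul0r x)); apply: eq_bigr => i _; rewrite !jbil.
Qed.

(** The product of exp (- [lser (t *: a)]) and 1 - t a has zero derivative in t, hence equals 1. *)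
Lemma jexp_lser a : `|a| < 1 -> jexp (lser a) = \e - a.
Proof.
move=> a1; have a0 := normr_ge0 a.
have r01 : 0 < (`|a| + 1) / 2 < 1 by lra.
have ar : `|a| <= (`|a| + 1) / 2 by lra.
have r0 : 0 < (`|a| + 1) / 2 by lra.
have gr : summable2 (fun=> -1) ((`|a| + 1) / 2).
  by apply: summable2_geometric r01 _ => n; rewrite normrN1.
have ta t : 0 <= t <= 1 -> `|t *: a| <= `|a|.
  by move=> /andP[t0 t1]; rewrite normrZ ger0_norm// ler_piMl.
pose l t := psum (fun n => - n%:R^-1) (t *: a).
pose g t := psum (fun=> -1) (t *: a).
have dql : dq l (fun t => a ** g t).
  apply: (psum_dq r0 ar (summable2_lser r01) gr) => n.
  by rewrite mulrN divff// pnatr_eq0.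
have al t : 0 <= t <= 1 -> alg a (l t).
  move=> t1; apply: (alg_trans (algZ t (alg_id a))).
  by apply: psum_alg (summable2_lser r01); apply: le_trans (ta t t1) ar.
have ag t : 0 <= t <= 1 -> alg a (g t).
  move=> t1; apply: (alg_trans (algZ t (alg_id a))).
  by apply: psum_alg gr; apply: le_trans (ta t t1) ar.
have := dq_const (dqM (dq_exp_comp (a := a) (dqN dql) _ _)
  (dqD (dq_cst \e) (dqN (dq_id a)))).
have l0 : l 0 = 0 by rewrite /l scale0r psum0 invr0 oppr0 scale0r.
rewrite l0 oppr0 jexp0 scale0r scale1r oppr0 addr0 jmul1x => H.
have aa1 : alg a (\e - a) by apply: algB; [exact: alg1|exact: alg_id].
rewrite -[RHS]jmul1x -[X in _ = X ** _](jexpNr (lser a)).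
rewrite (algA _ (jexp_alg (lser_alg a1)) aa1).
have -> : lser a = l 1 by rewrite /l scale1r.
rewrite H ?jmulx1//; [by move=> t /al; exact: algN|
  by move=> t /ag h; apply/algN/algl|move=> t t1].
rewrite add0r.
have ae : alg a (jexp (- l t)) by apply/jexp_alg/algN/al.
have ata : alg a (\e - t *: a) by apply: algB; [exact: alg1|apply/algZ/alg_id].
have E : g t = - \e + (t *: a) ** g t.
  by apply: geometric_psum; apply: le_lt_trans a1; exact: ta.
have {}E : t *: (a ** g t) = g t + \e.
  by rewrite -jmulZl [in RHS]E; lmod R.
rewrite (jmulC (- _)) (algA _ ae ata) -jmulDr (_ : _ + _ = 0) ?jmul0r//.
rewrite (_ : - (a ** g t) ** _ = a ** (t *: (a ** g t) - g t)); last first.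
  rewrite !jbil jmulx1 (jmulC _ a); lmod R.
by rewrite E !jbil jmulx1; lmod R.
Qed.

End Logarithm.

(** * The order defined by the norm *)

Section Positivity.
Context {R : realType} {V : jbAlgebraType R}.
Implicit Types (a b u v w x y z : V) (al c d r s t : R).

(* This is the cone of squares, described through the norm only. *)
Definition jpos b := exists al, `|al *: \e - b| <= al.

Lemma jpos_norm c a : `|a| <= c -> jpos (c *: \e - a).
Proof. by move=> ac; exists c; rewrite opprB addrC subrK. Qed.

Lemma jpos_normD c a : `|a| <= c -> jpos (c *: \e + a).
Proof. by move=> ac; rewrite -[a]opprK; apply: jpos_norm; rewrite normrN. Qed.

Lemma jposD a b : jpos a -> jpos b -> jpos (a + b).
Proof.
move=> [c ac] [d bd]; exists (c + d).
rewrite (_ : _ - _ = (c *: \e - a) + (d *: \e - b)); last by lmod R.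
by rewrite (le_trans (ler_normD _ _))// lerD.
Qed.

Lemma jposZ c a : 0 <= c -> jpos a -> jpos (c *: a).
Proof.
move=> c0 [d ad]; exists (c * d).
by rewrite -scalerA -scalerBr normrZ ger0_norm// ler_wpM2l.
Qed.

Lemma jpos_scalar c : 0 <= c -> jpos (c *: \e).
Proof. by move=> c0; exists c; rewrite subrr normr0. Qed.

(** The element is (al + d) (1 - a) with |a| < 1, so a scalar plus [lser a] is a logarithm of it. *)
Lemma jpos_exp b d : jpos b -> 0 < d ->
  exists2 u, alg b u & b + d *: \e = jexp u.
Proof.
move=> [al bal] d0; have al0 : 0 <= al by apply: le_trans bal.
have ad0 : 0 < al + d by rewrite ltr_wpDl.
pose a := (al + d)^-1 *: (al *: \e - b).
have a1 : `|a| < 1.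
  rewrite normrZ gtr0_norm ?invr_gt0// mulrC ltr_pdivrMr// mul1r.
  by rewrite (le_lt_trans bal)// ltrDl.
have [k kE] := expR_total ad0.
have ba : alg b a.
  by apply/algZ/algB; [apply/algZ/alg1|exact: alg_id].
have bl : alg b (lser a) by exact/(alg_trans ba)/lser_alg.
exists (k *: \e + lser a); first by apply: algD => //; apply/algZ/alg1.
rewrite (jexpD (algZ k (alg1 b)) bl) jexp_scalar kE jexp_lser// jmulZl jmul1x.
by rewrite scalerBr scalerA divff ?gt_eqF// scale1r; lmod R.
Qed.

(** For |y| < 1, 1 - y^2 is a square s^2 by the logarithm series, and the norm axiom gives |1 - y^2|
    <= |s^2 + y^2| = |1|. *)
Lemma jpos_sqr x : jpos (x ** x).
Proof.
have lt1 y : `|y| < 1 -> jpos (y ** y).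
  move=> y1; have yy1 : `|y ** y| < 1.
    by rewrite jnorm_sqr expr_lt1.
  exists 1; rewrite scale1r -(jexp_lser yy1).
  set s := jexp (2^-1 *: lser (y ** y)).
  have ss : s ** s = jexp (lser (y ** y)) by exact: jexp_half_sqr.
  have := jnorm_sqrD s y; rewrite ss [in X in _ <= `|X + _|]jexp_lser// subrK.
  by move=> /le_trans; apply; exact: norm_jone.
have x1 : 0 < `|x| + 1 by rewrite ltr_wpDl.
rewrite (_ : x ** x = (`|x| + 1) ^+ 2 *: (((`|x| + 1)^-1 *: x) ** ((`|x| + 1)^-1 *: x))).
  apply: jposZ; first exact: sqr_ge0.
  apply: lt1; rewrite normrZ gtr0_norm ?invr_gt0// mulrC ltr_pdivrMr// mul1r.
  by rewrite ltrDl.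
have xn0 : `|x| + 1 != 0 by rewrite gt_eqF.
by rewrite !jbil !scalerA (_ : _ * _ = 1) ?scale1r//; field.
Qed.

Lemma jpos_jexp u : jpos (jexp u).
Proof. by rewrite -jexp_half_sqr; exact: jpos_sqr. Qed.

(** Up to d, c^2 - a^2 = (c - a) (c + a) is the exponential of u + v, hence a square; the norm axiom
    then bounds |a^2| by c^2. *)
Lemma jpos_norm_le c a : 0 <= c -> jpos (c *: \e - a) -> jpos (c *: \e + a) ->
  `|a| <= c.
Proof.
move=> c0 ca1 ca2; apply/ler_addgt0Pr => d d0.
have [u au uE] := jpos_exp ca1 d0; have [v av vE] := jpos_exp ca2 d0.
have {}au : alg a u.
  by apply: alg_trans au; apply: algB (alg_id _); exact/algZ/alg1.
have {}av : alg a v.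
  by apply: alg_trans av; apply: algD (alg_id _); exact/algZ/alg1.
have := jnorm_sqrD a (jexp (2^-1 *: (u + v))).
rewrite jexp_half_sqr (jexpD au av) -uE -vE.
rewrite [X in _ <= `|X|](_ : _ = (c + d) ^+ 2 *: \e); last first.
  by rewrite !jbil !jmul1x jmulx1; lmod R.
rewrite jnorm_sqr normrZ ger0_norm ?sqr_ge0// => h.
have : `|a| ^+ 2 <= (c + d) ^+ 2.
  by rewrite (le_trans h)// ler_piMr ?sqr_ge0// norm_jone.
by rewrite ler_sqr ?nnegrE// addr_ge0// ltW.
Qed.

Lemma jpos_archimedean b : (forall d, 0 < d -> jpos (b + d *: \e)) -> jpos b.
Proof.
move=> bd; exists `|b|; apply/ler_addgt0Pr => d d0.
have b0 := normr_ge0 b; apply: jpos_norm_le; first by lra.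
  by rewrite (_ : _ - _ = b + d *: \e); [exact: bd|lmod R].
rewrite (_ : _ + _ = (2 * `|b| + d) *: \e - b); last by lmod R.
by apply: jpos_norm; lra.
Qed.

Lemma jpos_normE b : jpos b <-> `| `|b| *: \e - b| <= `|b|.
Proof.
split=> [bp|]; last by exists `|b|.
have b0 := normr_ge0 b; apply: jpos_norm_le => //.
  by rewrite opprB addrC subrK.
rewrite [X in jpos X](_ : _ = (2 * `|b|) *: \e - b); last by lmod R.
by apply: jpos_norm; lra.
Qed.

Lemma jpos_closed : closed [set b | jpos b].
Proof.
rewrite (_ : mkset _ =
    (fun b : V => `| `|b| *: \e - b| - `|b|) @^-1` [set r : R | r <= 0]).
  apply: closed_comp; last exact: closed_le.
  move=> b _.
  have h : (`|x| *: \e - x) @[x --> b] --> `|b| *: \e - b.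
    apply: (@cvgB _ V); last exact: cvg_id.
    by apply: cvgZr_tmp; exact: norm_continuous.
  exact: (cvgB (cvg_norm h) (@norm_continuous _ _ b)).
apply/seteqP; split => b /= h; first by rewrite subr_le0; exact/jpos_normE.
by apply/jpos_normE; rewrite -subr_le0.
Qed.

(** Both b + d / 3 and - b + d / 3 are squares and their sum is the scalar 2 d / 3, which bounds
    their norms. *)
Lemma jpos_anti b : jpos b -> jpos (- b) -> b = 0.
Proof.
move=> b1 b2; apply/eqP; rewrite -normr_le0; apply/ler_addgt0Pr => d d0.
rewrite add0r; have d3 : 0 < d / 3 by rewrite divr_gt0.
have [u _ uE] := jpos_exp b1 d3; have [v _ vE] := jpos_exp b2 d3.
have := jnorm_sqrD (jexp (2^-1 *: u)) (jexp (2^-1 *: v)).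
rewrite !jexp_half_sqr -uE -vE [X in _ <= `|X|](_ : _ = (2 * (d / 3)) *: \e); last by lmod R.
have n1 c : 0 <= c -> `|c *: \e : V| <= c.
  by move=> c0; rewrite normrZ ger0_norm// ler_piMr// norm_jone.
move=> h; rewrite -(addrK (d / 3 *: \e) b) (le_trans (ler_normB _ _))//.
by have := n1 _ (ltW d3); have := n1 (2 * (d / 3)); lra.
Qed.

(** After a small shift b is an exponential in the same subalgebra, and exponentials are positive; N
    keeps the error below d. *)
Lemma jpos_jexpM a b u : alg a b -> alg a u -> jpos b -> jpos (jexp u ** b).
Proof.
move=> ab au bp; apply: jpos_archimedean => d d0.
pose N := `|jexp u| + 1; have N0 : 0 < N by rewrite ltr_wpDl.
have dN : 0 < d / N by rewrite divr_gt0.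
have [p bp' pE] := jpos_exp bp dN; have ap := alg_trans ab bp'.
have -> : jexp u ** b + d *: \e = jexp (u + p) + (d / N) *: (N *: \e - jexp u).
  rewrite (jexpD au ap) -pE !jbil jmulx1 scalerBr scalerA divfK ?gt_eqF//.
  lmod R.
apply: jposD; first exact: jpos_jexp.
by apply: jposZ; [exact: ltW|apply: jpos_norm; rewrite lerDl].
Qed.

(** The interior of [jpos], which [jcone_ipos] identifies with the spectrally defined cone. *)
Definition ipos y := exists2 c, 0 < c & jpos (y - c *: \e).

Lemma ipos_jpos y : ipos y -> jpos y.
Proof.
move=> [c c0 yc]; rewrite -(subrK (c *: \e) y).
by apply: jposD => //; apply/jpos_scalar/ltW.
Qed.

Lemma ipos_exp y : ipos y -> exists2 u, alg y u & y = jexp u.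
Proof.
move=> [c c0 yc]; have [u yu uE] := jpos_exp yc c0; exists u.
  by apply: alg_trans yu; apply: algB (alg_id _) _; exact/algZ/alg1.
by rewrite -uE subrK.
Qed.

Lemma jexp_ge w c : 0 < c -> `|jexp (- w)| <= c -> jpos (jexp w - c^-1 *: \e).
Proof.
move=> c0 wc; rewrite (_ : _ - _ = c^-1 *: (jexp w ** (c *: \e - jexp (- w)))).
  apply: jposZ; first by rewrite invr_ge0 ltW.
  apply: (@jpos_jexpM w); [|exact: alg_id|exact: jpos_norm].
  by apply: algB; [exact/algZ/alg1|exact/jexp_alg/algN/alg_id].
by rewrite !jbil jmulx1 jexpNr scalerBr scalerA mulVf ?gt_eqF// scale1r.
Qed.

Lemma ipos_jexp w : ipos (jexp w).
Proof.
have N0 : 0 < `|jexp (- w)| + 1 by rewrite ltr_wpDl.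
exists (`|jexp (- w)| + 1)^-1; first by rewrite invr_gt0.
by apply: jexp_ge => //; rewrite lerDl.
Qed.

Lemma ipos1 : ipos \e.
Proof. by rewrite -jexp0; exact: ipos_jexp. Qed.

Lemma iposD y b : ipos y -> jpos b -> ipos (y + b).
Proof.
move=> [c c0 yc] bp; exists c => //.
by rewrite addrAC; exact: jposD.
Qed.

Lemma ipos_near y : ipos y -> exists2 c, 0 < c &
  forall z, `|y - z| <= c -> jpos (z - c *: \e).
Proof.
move=> [c c0 yc]; exists (c / 2); first by rewrite divr_gt0.
move=> z yz; rewrite (_ : _ - _ = (y - c *: \e) + ((c / 2) *: \e - (y - z))); last by lmod R.
by apply: jposD => //; exact: jpos_norm.
Qed.

Lemma ipos_open : open [set y | ipos y].
Proof.
rewrite openE => y /= /ipos_near[c c0 yc]; apply/nbhs_ballP; exists c => //= z.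
by rewrite -ball_normE /= => /ltW /yc zc; exists c.
Qed.

End Positivity.

(** * The spectral cone and its automorphisms *)

Section Cone.
Context {R : realType} {V : jbAlgebraType R}.
Implicit Types (a b u v w x y z : V) (c d r s t : R) (g h : bop V).

Lemma GLP g : GL V g <-> exists h, cancel h g /\ cancel g h.
Proof.
split=> [[h [gh hg]]|[h [gh hg]]]; exists h; split.
- by move=> x; rewrite -[LHS]/(bop_comp g h x) gh.
- by move=> x; rewrite -[LHS]/(bop_comp h g x) hg.
- by apply: bopE => x; exact: gh.
- by apply: bopE => x; exact: hg.
Qed.

Lemma GL_jU_jexp w : GL V (jU (jexp w)).
Proof.
apply/GLP; exists (jU (jexp (- w))); split => x; rewrite !jUE.
  exact: U_expK.
exact: U_expKV.
Qed.

(* If [U_z] is invertible, the elements [(z + d)^-2 = U_{z + d}^-1 1] stay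
   bounded as [d] tends to [0], hence so do the [(z + d)^-1]. *)
Lemma ipos_of_GL z : jpos z -> GL V (jU z) -> ipos z.
Proof.
move=> zp /GLP[h [_ hK]].
have K0 : 0 <= opnorm h.
  by apply: (le_trans _ (@opnorm_ge _ _ h 0 _)); rewrite ?normr0.
pose K := opnorm h + 1; pose L := 2 * `|z| + 1; pose M := 2 * K + 1.
have z0 := normr_ge0 z.
have K1 : 1 <= K by rewrite /K; lra.
have L1 : 1 <= L by rewrite /L; lra.
have M1 : 1 <= M by rewrite /M; lra.
have KL : 0 < K * L by rewrite mulr_gt0//; lra.
(* Makes d K L and d M at most 1/2: the former lets the terms in |c| be absorbed, the latter keeps
   M^-1 - d positive. *)
pose d := (2 * (K * L + M))^-1.
have D0 : 0 < 2 * (K * L + M) by lra.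
have d0 : 0 < d by rewrite invr_gt0.
have dE : d * (2 * (K * L + M)) = 1 by rewrite mulVf// gt_eqF.
have d1 : d <= 1 by nra.
have dKL : 2 * (d * (K * L)) <= 1.
  have : 0 <= d * M by rewrite mulr_ge0// ltW//; lra.
  by lra.
have dM : 2 * (d * M) <= 1.
  have : 0 <= d * (K * L) by rewrite mulr_ge0// ltW.
  by lra.
have [w _ wE] := jpos_exp zp d0.
pose c := jexp (- w) ** jexp (- w).
have Uc : U (jexp w) c = \e by rewrite /c -Ux1 U_expK.
have Uzc : U z c = \e - (2 * d) *: (z ** c) - d ^+ 2 *: c.
  by rewrite -Uc -wE /U !jbil !jmul1x jmulx1; lmod R.
have c0 := normr_ge0 c.
have cK : `|c| <= opnorm h * (1 + d * L * `|c|).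
  rewrite -{1}(hK c) jUE (le_trans (opnorm_apply _ _))// ler_wpM2l// Uzc.
  rewrite (le_trans (ler_normB _ _))// (le_trans (lerD (ler_normB _ _) (lexx _)))//.
  rewrite !normrZ !ger0_norm ?mulr_ge0 ?exprn_ge0 ?(ltW d0)//.
  have h1 : `|z ** c| <= `|z| * `|c| := jnorm_mul z c.
  have h2 : d * `|z ** c| <= d * (`|z| * `|c|) by rewrite ler_wpM2l// ltW.
  have h3 : d ^+ 2 * `|c| <= d * `|c| by rewrite ler_wpM2r// expr2 ler_piMl// ltW.
  by have h4 := norm_jone (V := V); rewrite /L; lra.
have c2K : `|c| <= 2 * K.
  have h1 : 0 <= 1 + d * L * `|c|.
    by rewrite addr_ge0// !mulr_ge0// ltW//; lra.
  have h2 : `|c| <= K * (1 + d * L * `|c|).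
    by rewrite (le_trans cK)// ler_wpM2r// /K lerDl.
  have h3 : 2 * (d * (K * L)) * `|c| <= 1 * `|c| by rewrite ler_wpM2r.
  by lra.
have wM : `|jexp (- w)| <= M.
  have : `|jexp (- w)| ^+ 2 <= M ^+ 2.
    by rewrite -jnorm_sqr -/c (le_trans c2K)// /M; nra.
  by rewrite ler_sqr ?nnegrE//; lra.
have M0 : 0 < M by lra.
exists (M^-1 - d).
  rewrite subr_gt0 -[ltRHS]mul1r ltr_pdivlMr//; nra.
rewrite (_ : _ - _ = jexp w - M^-1 *: \e); first exact: jexp_ge.
by rewrite -wE; lmod R.
Qed.

(** The parameters with p t in the interior form an open set, and also a closed one, since by
    [ipos_of_GL] a positive element with invertible U is interior. *)
Lemma ipos_path (p : R -> V) : continuous p ->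
  (forall t, 0 <= t <= 1 -> GL V (jU (p t))) -> ipos (p 0) -> ipos (p 1).
Proof.
move=> pc pGL p0; pose B := [set t | 0 <= t <= 1 /\ ipos (p t)].
suff BE : B = `[0, 1]%classic.
  have : B 1 by rewrite BE /= in_itv/= lexx ler01.
  by case.
have h0 : 0 <= (0 : R) <= 1 by rewrite lexx ler01.
apply: (@segment_connected R 0 1 B).
- by exists 0.
- exists (p @^-1` [set y | ipos y]).
    by apply: open_comp ipos_open => t _; exact: pc.
  by apply/seteqP; split => t /=; rewrite in_itv.
- exists (p @^-1` [set y | jpos y]).
    by apply: closed_comp jpos_closed => t _; exact: pc.
  apply/seteqP; split => t /=; rewrite in_itv/= => -[t1 tp]; split => //.
    exact: ipos_jpos.
  by apply: ipos_of_GL => //; exact: pGL.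
Qed.

Lemma jcone_ipos : @jcone R V = [set y | ipos y].
Proof.
apply/seteqP; split => y /= yP; last first.
  move=> l /= ly; rewrite ltNge; apply/negP => l0; apply: ly.
  have : ipos (y - l *: \e).
    by rewrite -scaleNr; apply/iposD/jpos_scalar => //; rewrite oppr_ge0.
  by move=> /ipos_exp[u _ ->]; exact: GL_jU_jexp.
(* Along this segment U stays invertible because the spectrum of y contains no number l <= 0. *)
pose p t := y + ((1 - t) * (`|y| + 1)) *: \e.
have -> : y = p 1 by rewrite /p subrr mul0r scale0r addr0.
apply: ipos_path.
- move=> t; apply: cvgD; first exact: cvg_cst.
  apply: cvgZr_tmp; exact: (cvgM (cvgB (cvg_cst _) cvg_id) (cvg_cst _)).
- move=> t /andP[t0 t1]; apply: contrapT => pt.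
  have /yP/= : jspectrum y (- ((1 - t) * (`|y| + 1))).
    by rewrite /jspectrum/= scaleNr opprK.
  rewrite oppr_gt0 ltNge => /negP; apply.
  by rewrite mulr_ge0// subr_ge0.
- rewrite /p subr0 mul1r; exists 1 => //.
  rewrite (_ : _ - _ = `|y| *: \e + y); first exact: jpos_normD.
  lmod R.
Qed.

(** Along the path U_{exp (t x)} y, the fundamental formula keeps U invertible, so the path stays in
    the interior. *)
Lemma ipos_U x y : ipos y -> ipos (U (jexp x) y).
Proof.
move=> yP; have [u _ yE] := ipos_exp yP.
pose p t := U (jexp (t *: x)) y.
have -> : U (jexp x) y = p 1 by rewrite /p scale1r.
apply: ipos_path.
- move=> t; have ec : jexp (r *: x) @[r --> t] --> jexp (t *: x).
    apply: (continuous_cvg _ (@jexp_continuous _ _ _)).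
    by apply: cvgZr_tmp; exact: cvg_id.
  apply: cvgB.
    apply: cvgZl_tmp; apply: cvg_jmul => //; apply: cvg_jmul => //; exact: cvg_cst.
  by apply: cvg_jmul; [exact: cvg_jmul|exact: cvg_cst].
- move=> t _; apply/GLP.
  exists (bop_comp (jU (jexp (- (t *: x))))
    (bop_comp (jU (jexp (- u))) (jU (jexp (- (t *: x)))))).
  split => z; rewrite /p yE.
    rewrite -[LHS]/(U (U (jexp (t *: x)) (jexp u)) (U (jexp (- (t *: x)))
      (U (jexp (- u)) (U (jexp (- (t *: x))) z)))).
    by rewrite U_fundamental !U_expK.
  rewrite -[LHS]/(U (jexp (- (t *: x))) (U (jexp (- u)) (U (jexp (- (t *: x)))
    (U (U (jexp (t *: x)) (jexp u)) z)))).
  by rewrite U_fundamental !U_expKV.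
- by rewrite /p scale0r jexp0 U1l.
Qed.

Lemma jpos_U x b : jpos b -> jpos (U (jexp x) b).
Proof.
move=> bp; apply: jpos_archimedean => d d0.
pose N := `|jexp x ** jexp x| + 1; have N0 : 0 < N by rewrite ltr_wpDl.
have dN : 0 < d / N by rewrite divr_gt0.
rewrite (_ : _ + _ = U (jexp x) (b + (d / N) *: \e) +
                     (d / N) *: (N *: \e - jexp x ** jexp x)); last first.
  by rewrite UDr UZr Ux1 scalerBr scalerA divfK ?gt_eqF//; lmod R.
apply: jposD; last first.
  by apply: jposZ; [exact: ltW|apply: jpos_norm; rewrite lerDl].
apply/ipos_jpos/ipos_U; exists (d / N) => //.
by rewrite addrK.
Qed.

Lemma GconeP g : Gcone g <-> exists h, [/\ cancel h g, cancel g h,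
  (forall y, ipos y -> ipos (g y)) & (forall y, ipos y -> ipos (h y))].
Proof.
rewrite /Gcone jcone_ipos; split=> [[/GLP[h [gh hg]] gC]|[h [gh hg gi hi]]].
  exists h; split=> // y yP.
    by have : (g @` [set y | ipos y]) (g y) by [exists y]; rewrite gC.
  have : [set y | ipos y] y by [].
  by rewrite -gC => -[z zP <-]; rewrite hg.
split; first by apply/GLP; exists h.
apply/seteqP; split => [_ [y yP <-]|y yP]; first exact: gi.
by exists (h y); [exact: hi|exact: gh].
Qed.

Lemma Gcone_jU x : Gcone (jU (jexp x)).
Proof.
apply/GconeP; exists (jU (jexp (- x))); split => y; rewrite ?jUE.
- exact: U_expK.
- exact: U_expKV.
- exact: ipos_U.
- exact: ipos_U.
Qed.

Lemma Gcone_comp g h : Gcone g -> Gcone h -> Gcone (bop_comp g h).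
Proof.
move=> /GconeP[g' [g1 g2 g3 g4]] /GconeP[h' [h1 h2 h3 h4]].
apply/GconeP; exists (bop_comp h' g'); split => y /=.
- by rewrite h1 g1.
- by rewrite g2 h2.
- by move=> /h3/g3.
- by move=> /g4/h4.
Qed.

Lemma Gcone_jpos g b : Gcone g -> jpos b -> jpos (g b).
Proof.
move=> /GconeP[_ [_ _ gi _]] bp; apply: jpos_archimedean => d d0.
pose N := `|g \e| + 1; have N0 : 0 < N by rewrite ltr_wpDl.
have dN : 0 < d / N by rewrite divr_gt0.
rewrite (_ : _ + _ = g (b + (d / N) *: \e) + (d / N) *: (N *: \e - g \e)); last first.
  by rewrite linearD linearZ/= scalerBr scalerA divfK ?gt_eqF//; lmod R.
apply: jposD; last first.
  by apply: jposZ; [exact: ltW|apply: jpos_norm; rewrite lerDl].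
by apply/ipos_jpos/gi; exists (d / N) => //; rewrite addrK.
Qed.

End Cone.

(** * Inversion, the Thompson metric and unital cone automorphisms *)

Section Inverse.
Context {R : realType} {V : jbAlgebraType R}.
Implicit Types (a b u v w x y z : V) (c d k l r s t : R) (g h : bop V).

(** The subalgebras of u and v may differ, but a logarithm w taken in the subalgebra of exp u = exp
    v lies in both, so u = w = v. *)
Lemma jexp_inj : injective (@jexp R V).
Proof.
move=> u v uv; have [w yw yE] := ipos_exp (ipos_jexp u).
have uw : u = w.
  apply: (jexp_inj_alg (alg_id u) _ yE).
  exact/(alg_trans _ yw)/jexp_alg/alg_id.
rewrite uv in yw yE; rewrite uw.
apply/esym/(jexp_inj_alg (alg_id v) _ yE).
exact/(alg_trans _ yw)/jexp_alg/alg_id.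
Qed.

Lemma jexpK u : jln (jexp u) = u.
Proof.
rewrite /jln; apply: jexp_inj.
by case: xgetP => [x _ ->|/(_ u) /=].
Qed.

Lemma jlnK y : ipos y -> jexp (jln y) = y.
Proof. by move=> /ipos_exp[u _ ->]; rewrite jexpK. Qed.

Lemma jln_alg y : ipos y -> alg y (jln y).
Proof. by move=> /ipos_exp[u + yE]; rewrite -[X in alg y X](jexpK u) -yE. Qed.

Definition jinv y := jexp (- jln y).

Lemma jinv_jexp u : jinv (jexp u) = jexp (- u).
Proof. by rewrite /jinv jexpK. Qed.

Lemma ipos_jinv y : ipos (jinv y).
Proof. exact: ipos_jexp. Qed.

Lemma jinvK y : ipos y -> jinv (jinv y) = y.
Proof. by move=> yP; rewrite {2}/jinv jinv_jexp opprK jlnK. Qed.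

Lemma jinv_alg y : ipos y -> alg y (jinv y).
Proof. by move=> yP; apply/jexp_alg/algN/jln_alg. Qed.

Lemma jinv1 : jinv \e = \e.
Proof. by rewrite -[X in jinv X]jexp0 jinv_jexp oppr0 jexp0. Qed.

Lemma jmul_jinv y : ipos y -> y ** jinv y = \e.
Proof. by move=> yP; rewrite -{1}(jlnK yP) jexpNr. Qed.

Lemma U_jinv y : ipos y -> U y (jinv y) = y.
Proof.
move=> yP; rewrite /U (algA _ (alg_id y) (jinv_alg yP)) jmul_jinv// jmulx1; lmod R.
Qed.

Lemma U_inj y : ipos y -> injective (U y).
Proof.
by move=> /ipos_exp[u _ ->] a b ab; rewrite -(U_expKV u a) ab U_expKV.
Qed.

(** With z = U_{exp x} y, both sides solve U_z s = z, and U_z is injective. *)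
Lemma jinv_U x y : ipos y -> jinv (U (jexp x) y) = U (jexp (- x)) (jinv y).
Proof.
move=> yP; apply: (@U_inj (U (jexp x) y)); first exact: ipos_U.
by rewrite U_jinv ?U_fundamental ?U_expK ?U_jinv//; exact: ipos_U.
Qed.

Lemma U_jexpNhalf u : U (jexp (- (2^-1 *: u))) (jexp u) = \e.
Proof. by rewrite -(jexp_half_sqr u) -Ux1 U_expKV. Qed.

(** The operator U of exp (- u / 2) sends x to 1 and y to some exp v >= 1; there 1 - exp (- v) is
    the product of exp (- v) and exp v - 1. The same operator carries this difference back. *)
Lemma jinv_le x y : ipos x -> ipos y -> jpos (y - x) -> jpos (jinv x - jinv y).
Proof.
move=> /ipos_exp[u _ ->] yP xy.
pose e := 2^-1 *: u.
have eu : U (jexp (- e)) \e = jexp (- u) by rewrite Ux1 /e -scalerN jexp_half_sqr.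
have [v _ vE] := ipos_exp (ipos_U (- e) yP).
have v1 : jpos (jexp v - \e).
  by rewrite -vE -(U_jexpNhalf u) -UNr -UDr; exact: jpos_U.
rewrite jinv_jexp -eu.
have -> : jinv y = U (jexp (- e)) (jexp (- v)).
  by rewrite -(jinv_jexp v) -vE jinv_U// opprK U_expKV.
rewrite -UNr -UDr; apply: jpos_U.
rewrite (_ : _ - _ = jexp (- v) ** (jexp v - \e)); last first.
  by rewrite !jbil jmulx1 jmulC jexpNr.
apply: (@jpos_jexpM _ _ v) v1; last exact/algN/alg_id.
by apply: algB; [exact/jexp_alg/alg_id|exact: alg1].
Qed.

Lemma iposZ c x : 0 < c -> ipos x -> ipos (c *: x).
Proof.
move=> c0 [d d0 dx]; exists (c * d); first exact: mulr_gt0.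
by rewrite -scalerA -scalerBr; apply: jposZ => //; exact: ltW.
Qed.

Lemma jinvZ c x : 0 < c -> ipos x -> jinv (c *: x) = c^-1 *: jinv x.
Proof.
move=> c0 /ipos_exp[u _ ->]; have [k kE] := expR_total c0.
have sE r v : expR r *: jexp v = jexp (r *: \e + v).
  by rewrite (jexpD (algZ r (alg1 v)) (alg_id v)) jexp_scalar jmulZl jmul1x.
rewrite -kE sE !jinv_jexp -expRN sE; congr jexp; lmod R.
Qed.

(* [thom k x y] says that the Thompson distance of [x] and [y] is at most
   [ln k]. *)
Definition thom k x y := jpos (k *: y - x) /\ jpos (k *: x - y).

Lemma thom_sym k x y : thom k x y -> thom k y x.
Proof. by case. Qed.

Lemma thom_trans k l x y z : 0 <= k -> 0 <= l ->
  thom k x y -> thom l y z -> thom (k * l) x z.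
Proof.
move=> k0 l0 [xy yx] [yz zy]; split.
  rewrite (_ : _ - _ = k *: (l *: z - y) + (k *: y - x)); last by lmod R.
  by apply: jposD => //; exact: jposZ.
rewrite (_ : _ - _ = l *: (k *: x - y) + (l *: y - z)); last by lmod R.
by apply: jposD => //; exact: jposZ.
Qed.

Lemma thom_le k l x y : jpos x -> jpos y -> k <= l -> thom k x y -> thom l x y.
Proof.
move=> xP yP kl [xy yx]; have kl0 : 0 <= l - k by rewrite subr_ge0.
split.
  rewrite (_ : _ - _ = (k *: y - x) + (l - k) *: y); last by lmod R.
  by apply: jposD => //; exact: jposZ.
rewrite (_ : _ - _ = (k *: x - y) + (l - k) *: x); last by lmod R.
by apply: jposD => //; exact: jposZ.
Qed.

Lemma thom_Gcone g k x y : Gcone g -> thom k x y -> thom k (g x) (g y).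
Proof.
by move=> gG [xy yx]; split; rewrite -linearZ -linearB; exact: Gcone_jpos.
Qed.

Lemma thom_jinv k x y : 0 < k -> ipos x -> ipos y -> thom k x y ->
  thom k (jinv x) (jinv y).
Proof.
move=> k0 + + [].
have H a b : ipos a -> ipos b -> jpos (k *: b - a) -> jpos (k *: jinv a - jinv b).
  move=> aP bP ab; have := jinv_le aP (iposZ k0 bP) ab.
  rewrite jinvZ// => /(jposZ (ltW k0)).
  by rewrite scalerBr scalerA divff ?gt_eqF// scale1r.
by move=> xP yP xy yx; split; exact: H.
Qed.

(** Multiplication by exp u gives exp (2 u) <= k^2, hence |exp u|^2 <= k^2. *)
Lemma jexp_le_of_inv k u : 0 < k -> jpos (k ^+ 2 *: jexp (- u) - jexp u) ->
  jpos (k *: \e - jexp u).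
Proof.
move=> k0 h; apply: jpos_norm.
have : `|jexp u ** jexp u| <= k ^+ 2.
  apply: jpos_norm_le; rewrite ?sqr_ge0//; last first.
    by apply: jposD; [exact/jpos_scalar/sqr_ge0|exact: jpos_sqr].
  rewrite (_ : _ - _ = jexp u ** (k ^+ 2 *: jexp (- u) - jexp u)).
    apply: (@jpos_jexpM _ _ u) h; last exact: alg_id.
    by apply: algB; [apply: algZ|]; apply: jexp_alg; [exact/algN/alg_id|exact: alg_id].
  by rewrite !jbil jexpNr.
by rewrite jnorm_sqr ler_sqr ?nnegrE// ltW.
Qed.

(** The distance from x to its inverse is at least twice that from x to 1. *)
Lemma thom_double k x : 0 < k -> ipos x -> thom (k ^+ 2) x (jinv x) -> thom k x \e.
Proof.
move=> k0 /ipos_exp[u _ ->]; rewrite jinv_jexp => -[h1 h2]; split.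
  exact: jexp_le_of_inv.
have := @jexp_le_of_inv k (- u) k0; rewrite opprK => /(_ h2) h3.
rewrite (_ : _ - _ = jexp u ** (k *: \e - jexp (- u))).
  apply: (@jpos_jexpM _ _ u) h3; last exact: alg_id.
  by apply: algB; [exact/algZ/alg1|exact/jexp_alg/algN/alg_id].
by rewrite !jbil jmulx1 jexpNr.
Qed.

Lemma thom_bound x : ipos x -> exists2 k, 0 < k & thom k x \e.
Proof.
move=> /ipos_exp[u _ ->].
have n0 : 0 < `|jexp (- u)| + 1 by rewrite ltr_wpDl.
have a0 := normr_ge0 (jexp u); have b0 := normr_ge0 (jexp (- u)).
exists (`|jexp u| + (`|jexp (- u)| + 1)); first by lra.
split; first by apply: jpos_norm; lra.
have := jexp_ge (w := u) n0; rewrite lerDl ler01 => /(_ isT)/(jposZ (ltW n0)).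
rewrite scalerBr scalerA divff ?gt_eqF// scale1r => h.
rewrite scalerDl -addrA; apply: jposD => //.
by apply: jposZ => //; exact: jpos_jexp.
Qed.

Lemma thom_eq1 x : (forall k, 1 < k -> thom k x \e) -> x = \e.
Proof.
move=> h; apply/subr0_eq/jpos_anti; apply: jpos_archimedean => d d0.
  have N0 : 0 < `|x| + 1 by rewrite ltr_wpDl.
  have dN : 0 < d / (`|x| + 1) by rewrite divr_gt0.
  have [|_ h2] := h (1 + d / (`|x| + 1)); first by rewrite ltrDl.
  rewrite (_ : _ + _ = ((1 + d / (`|x| + 1)) *: x - \e) +
    d / (`|x| + 1) *: ((`|x| + 1) *: \e - x)); last first.
    by rewrite [in RHS]scalerBr scalerA divfK ?gt_eqF//; lmod R.
  apply: jposD => //; apply: jposZ; first exact: ltW.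
  by apply: jpos_norm; rewrite lerDl.
have [|h1 _] := h (1 + d); first by rewrite ltrDl.
by rewrite (_ : _ + _ = (1 + d) *: \e - x)//; lmod R.
Qed.

(** Bijective isometries of the Thompson metric on the open cone, in a form symmetric in the map and
    its inverse. *)
Definition biso (f fi : V -> V) :=
  [/\ forall x, ipos x -> ipos (f x), forall x, ipos x -> fi (f x) = x &
      forall k x y, 0 < k -> ipos x -> ipos y -> thom k x y -> thom k (f x) (f y)] /\
  [/\ forall x, ipos x -> ipos (fi x), forall x, ipos x -> f (fi x) = x &
      forall k x y, 0 < k -> ipos x -> ipos y -> thom k x y -> thom k (fi x) (fi y)].

Lemma biso_sym f fi : biso f fi -> biso fi f.
Proof. by case. Qed.

Lemma biso_comp f fi f' fi' : biso f fi -> biso f' fi' ->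
  biso (f \o f') (fi' \o fi).
Proof.
have H p pi p' pi' : biso p pi -> biso p' pi' ->
    [/\ forall x, ipos x -> ipos ((p \o p') x),
      forall x, ipos x -> (pi' \o pi) ((p \o p') x) = x &
      forall k x y, 0 < k -> ipos x -> ipos y -> thom k x y ->
        thom k ((p \o p') x) ((p \o p') y)].
  move=> [[p1 p2 p3] _] [[q1 q2 q3] _]; split => [x xP|x xP|k x y k0 xP yP xy] /=.
  - exact/p1/q1.
  - by rewrite p2 ?q2//; exact: q1.
  - by apply: p3 => //; [exact: q1|exact: q1|exact: q3].
by move=> fb fb'; split; apply: H => //; exact: biso_sym.
Qed.

Lemma biso_jinv : biso jinv jinv.
Proof.
by split; split=> [x _|x|k x y]; [exact: ipos_jinv|exact: jinvK|exact: thom_jinv|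
  exact: ipos_jinv|exact: jinvK|exact: thom_jinv].
Qed.

Lemma biso_Gcone g : Gcone g -> exists h, biso g h.
Proof.
move=> gG; have /GconeP[h [gh hg gi hi]] := gG.
have hG : Gcone h by apply/GconeP; exists g.
exists h; split; split => // k x y _ _ _; exact: thom_Gcone.
Qed.

(* Mazur-Ulam argument: if [f] is an isometry fixing [a] and its inverse, then
   so is [inv o f^-1 o inv o f], and it moves [1] twice as far as [f] does. *)
Lemma biso_fix1 f fi a : ipos a -> biso f fi -> f a = a -> f (jinv a) = jinv a ->
  f \e = \e.
Proof.
move=> aP fb fa fa'; have [C C0 aC] := thom_bound aP.
(* An isometry fixing a displaces 1 by at most 2 ln C, where ln C bounds the distance from a to 1.
   Since each round doubles the displacement, n rounds improve the bound for p to 2 ln C / 2^n. *)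
suff main n k p pi : biso p pi -> p a = a -> p (jinv a) = jinv a ->
    0 < k -> C ^+ 2 <= k ^+ (2 ^ n) -> thom k (p \e) \e.
  apply: thom_eq1 => k k1; have k0 : 0 < k by exact: lt_trans k1.
  have k1' : 0 < k - 1 by rewrite subr_gt0.
  have bern m : 1 + m%:R * (k - 1) <= k ^+ m.
    elim: m => [|m IHm]; first by rewrite mul0r addr0 expr0.
    rewrite exprS -natr1; have : 0 <= (m%:R : R) by [].
    move: IHm; move: (m%:R : R) (k ^+ m) => p q pq p0.
    have h1 : k * (1 + p * (k - 1)) <= k * q by rewrite ler_pM2l.
    have h2 : 0 <= p * (k - 1) ^+ 2 by rewrite mulr_ge0// sqr_ge0.
    by apply: le_trans h1; rewrite -subr_ge0 (_ : _ - _ = p * (k - 1) ^+ 2)//; ring.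
  pose n := (Num.truncn (C ^+ 2 / (k - 1))).+1.
  apply: (main n _ _ _ fb fa fa' k0).
  have Cn : C ^+ 2 <= n%:R * (k - 1).
    by rewrite -ler_pdivrMr// ltW// truncnS_gt.
  rewrite (le_trans Cn)// (le_trans _ (bern _))//.
  have h1 : n%:R * (k - 1) <= (2 ^ n)%:R * (k - 1).
    by rewrite ler_pM2r// ler_nat ltnW// ltn_expl.
  by lra.
elim: n k p pi => [|n IHn] k p pi pb pa pa' k0 kC.
  have [[pP piK pT] [piP pK piT]] := pb.
  have p1 : ipos (p \e) by apply: pP; exact: ipos1.
  have kC' : C * C <= k by move: kC; rewrite expn0 expr1 expr2.
  apply: (thom_le (ipos_jpos p1) (ipos_jpos ipos1) kC').
  apply: (thom_trans (ltW C0) (ltW C0) _ aC).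
  apply: thom_sym; rewrite -{1}pa; apply: (pT _ _ _ C0 aP ipos1 aC).
have [[pP piK pT] [piP pK piT]] := pb.
(* This isometry again fixes a and its inverse, as inversion swaps the two. *)
have qb : biso ((jinv \o pi) \o (jinv \o p)) ((pi \o jinv) \o (p \o jinv)).
  apply: biso_comp; first exact: biso_comp biso_jinv (biso_sym pb).
  exact: biso_comp biso_jinv pb.
have aP' := ipos_jinv a.
have pia : pi a = a by rewrite -{1}pa piK.
have pia' : pi (jinv a) = jinv a by rewrite -{1}pa' piK.
have := IHn (k ^+ 2) _ _ qb; rewrite /= pa pia' pa' !jinvK// pia.
move=> /(_ erefl erefl) h; have k20 : 0 < k ^+ 2 by rewrite exprn_gt0.
have p1 : ipos (p \e) by apply: pP; exact: ipos1.
have jp1 := ipos_jinv (p \e).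
have pij : ipos (pi (jinv (p \e))) by exact: piP.
have {}h := h k20; rewrite -exprM -expnS in h.
have := thom_jinv k20 (ipos_jinv _) ipos1 (h kC); rewrite jinvK// jinv1.
move=> /(pT _ _ _ k20 pij ipos1); rewrite pK// => /thom_sym.
exact: thom_double.
Qed.

Lemma Gcone_jinv g x : Gcone g -> g \e = \e -> ipos x -> g (jinv x) = jinv (g x).
Proof.
move=> gG g1 xP; have [gi gb] := biso_Gcone gG.
have [[gP giK _] [giP gK _]] := gb.
have bP : ipos (g x) by exact: gP.
have b'P : ipos (g (jinv x)) by apply/gP/ipos_jinv.
set b := g x in bP *; set b' := g (jinv x) in b'P *.
pose e := 2^-1 *: jln b.
have bE : b = jexp (jln b) by rewrite jlnK.
have [Q _ QE] := ipos_exp (ipos_U (- e) b'P).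
(* The geometric mean of b and b', so that y |-> U_m y^-1 exchanges b and b'. *)
pose m := U (jexp e) (jexp (2^-1 *: Q)).
have [M _ ME] : exists2 M, alg m M & m = jexp M.
  exact/ipos_exp/ipos_U/ipos_jexp.
have UmE y : U m y = U (jexp e) (U (jexp (2^-1 *: Q)) (U (jexp e) y)).
  exact: U_fundamental.
have ee : U (jexp e) \e = b by rewrite Ux1 /e jexp_half_sqr -bE.
have Umb : U m (jinv b) = b'.
  have -> : jinv b = U (jexp (- e)) \e by rewrite -ee jinv_U ?jinv1//; exact: ipos1.
  by rewrite UmE U_expK Ux1 jexp_half_sqr -QE U_expK.
have Umb' : U m (jinv b') = b by rewrite -Umb ME jinv_U ?jinvK ?U_expK//; exact: ipos_jinv.
have [mi mb] : exists mi, biso (U m) mi.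
  have [mi mb] := biso_Gcone (Gcone_jU M); exists mi.
  by rewrite ME (_ : U _ = jU (jexp M))//; apply/funext => y; rewrite jUE.
(* The reflection, conjugated by g and followed by inversion, fixes x and x^-1, hence 1. As g fixes
   1, so does U_m, which forces m = 1 and b' = b^-1. *)
pose f := (jinv \o gi) \o ((U m \o jinv) \o g).
have fb : biso f ((gi \o (jinv \o mi)) \o (g \o jinv)).
  exact: (biso_comp (biso_comp biso_jinv (biso_sym gb)) (biso_comp (biso_comp mb biso_jinv) gb)).
have f1 : f \e = \e.
  apply: (biso_fix1 xP fb).
    by rewrite /f /= -/b Umb /b' giK ?jinvK//; exact: ipos_jinv.
  by rewrite /f /= -/b' Umb' /b giK.
have {}f1 : U m \e = \e.
  have Um1 : ipos (U m \e) by rewrite ME; exact/ipos_U/ipos1.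
  have E : jinv (gi (U m \e)) = \e by have := f1; rewrite /f /= g1 jinv1.
  have {}E : gi (U m \e) = \e by rewrite -(jinvK (giP _ Um1)) E jinv1.
  by rewrite -(gK _ Um1) E.
have M0 : M = 0.
  have : 2 *: M = 0 by apply/jexp_eq1; rewrite -jexp_double -ME -Ux1.
  by move/eqP; rewrite scaler_eq0 pnatr_eq0 => /eqP.
by rewrite -Umb ME M0 jexp0 U1l.
Qed.

Lemma jinvD_compl a : ipos a -> ipos (\e - a) ->
  jinv (jinv a + jinv (\e - a)) = a - a ** a.
Proof.
move=> aP bP; set b := \e - a in bP *.
have ab : alg a b by apply: algB; [exact: alg1|exact: alg_id].
have au := jln_alg aP; have av : alg a (jln b) by exact: (alg_trans ab (jln_alg bP)).
have aa' := jinv_alg aP; have ab' : alg a (jinv b) by exact: (alg_trans ab (jinv_alg bP)).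
have sE : a - a ** a = jexp (jln a + jln b).
  by rewrite (jexpD au av) !jlnK// /b !jbil jmulx1.
suff -> : jinv a + jinv b = jexp (- (jln a + jln b)) by rewrite jinv_jexp opprK.
rewrite opprD (jexpD (algN au) (algN av)) -!/(jinv _).
have baE : b + a = \e by rewrite subrK.
rewrite -[RHS]jmulx1 -baE jmulDr; congr (_ + _).
  by rewrite (algA _ aa' ab) (jmulC _ b) jmul_jinv// jmulx1.
by rewrite (jmulC _ a) -(algA _ (alg_id a) ab') jmul_jinv// jmul1x.
Qed.

Lemma Gcone_unital_jmul g x y : Gcone g -> g \e = \e -> g (x ** y) = g x ** g y.
Proof.
move=> gG g1; have /GconeP[_ [_ _ gP _]] := gG.
have sqr_small a : ipos a -> ipos (\e - a) -> g (a ** a) = g a ** g a.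
  move=> aP bP; have gaP := gP _ aP.
  have gbP : ipos (\e - g a) by rewrite -g1 -linearB; exact: gP.
  have pP : ipos (jinv a + jinv (\e - a)).
    by apply: iposD; [|apply: ipos_jpos]; exact: ipos_jinv.
  have := jinvD_compl gaP gbP; rewrite -(Gcone_jinv gG g1 aP).
  rewrite -[in jinv (\e - _)]g1 -linearB -(Gcone_jinv gG g1 bP) -linearD.
  rewrite -(Gcone_jinv gG g1 pP) jinvD_compl// linearB => h.
  by apply: oppr_inj; apply: (addrI (g a)).
have sqr z : g (z ** z) = g z ** g z.
  (* This scale puts a = 1/2 + t z between 1/4 and 3/4, where the formula for a - a^2 applies. *)
  pose t := (4 * (`|z| + 1))^-1.
  have z0 := normr_ge0 z.
  have D0 : 0 < 4 * (`|z| + 1) by lra.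
  have t0 : 0 < t by rewrite invr_gt0.
  have tz : `|t *: z| <= 4^-1.
    rewrite normrZ gtr0_norm// /t invfM -mulrA ler_piMr// mulrC ler_pdivrMr; lra.
  pose a := 2^-1 *: \e + t *: z.
  have aP : ipos a.
    exists 4^-1; first by rewrite invr_gt0.
    rewrite (_ : _ - _ = 4^-1 *: \e + t *: z); first exact: jpos_normD.
    by rewrite /a; lmod R.
  have bP : ipos (\e - a).
    exists 4^-1; first by rewrite invr_gt0.
    rewrite (_ : _ - _ = 4^-1 *: \e - t *: z); first exact: jpos_norm.
    by rewrite /a; lmod R.
  have := sqr_small a aP bP; rewrite /a linearD !linearZ/= g1 !jbil !jmul1x !jmulx1.
  rewrite !linearD !linearZ/= g1 !scalerA => h.
  have tt : t * t != 0 by rewrite mulf_neq0// gt_eqF.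
  apply: (scalerI tt); apply: (@lin_comb1 R V _ _ _ _ 1 h); lmod R.
have := sqr (x + y); rewrite !jbil !linearD/= !jbil !sqr (jmulC y x) (jmulC (g y)).
move=> h; apply: (@lin_comb1 R V _ _ _ _ 2^-1 h); lmod R.
Qed.

End Inverse.

(** * Connected components of a strong deformation retract *)

Section DeformationRetracts.

Lemma continuous_within_comp (S T U : topologicalType) (A : set S) (B : set T)
    (f : S -> T) (g : T -> U) : continuous f -> (forall x, A x -> B (f x)) ->
  {within B, continuous g} -> {within A, continuous (g \o f)}.
Proof.
move=> fc AB /subspace_continuousP gc; apply/subspace_continuousP => x Ax.
apply: (@cvg_comp _ _ _ f g _ (within B (nbhs (f x)))); last exact/gc/AB.
move=> W wW; have fW : nbhs x (f @^-1` [set y | B y -> W y]) by exact: fc.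
suff : nbhs x [set y | A y -> W (f y)] by [].
by apply: filterS fW => y /= h Ay; apply: h; exact: AB.
Qed.

Lemma connected_components_retract (R : realType) (T : topologicalType)
    (X A : set T) (F : T * R -> T) : strong_deformation_retract X A F ->
  (connected_components X #= connected_components A)%card.
Proof.
move=> [AX Fc FX F01 FA].
have i1 : 0 <= (1 : R) <= 1 by rewrite ler01 lexx.
have i0 : 0 <= (0 : R) <= 1 by rewrite ler01 lexx.
pose r x := F (x, 1).
have rX x : X x -> connected_component X x (r x).
  move=> Xx; pose B := (fun t => F (x, t)) @` `[0, 1]%classic.
  have Bc : connected B.
    apply: connected_continuous_connected; first exact: segment_connected.
    apply: (@continuous_within_comp _ _ _ _ _ (fun t => (x, t)) F _ _ Fc).
      by move=> t; exact: (cvg_pair (cvg_cst x) cvg_id).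
    by move=> t.
  have BX : B `<=` X.
    by move=> _ [t t1 <-]; apply: FX => //; move: t1; rewrite /= in_itv.
  have Bx : B x by exists 0; [rewrite /= in_itv|exact: (F01 x Xx).1].
  apply: (connected_component_max Bx BX Bc).
  by exists 1 => //; rewrite /= in_itv.
have rc : {within X, continuous r}.
  have -> : r = F \o (fun x => (x, 1 : R)) by [].
  apply: (continuous_within_comp _ _ Fc).
    by move=> t; exact: (cvg_pair cvg_id (cvg_cst (1 : R))).
  by move=> x Xx; split => //=; rewrite in_itv.
(* The image under r of a component of X is connected and lies in A, and r fixes the points of A. *)
have AXA a b : A a -> A b -> connected_component X a b -> connected_component A a b.
  move=> Aa Ab ab; pose C := connected_component X a.
  have rC : connected (r @` C).
    apply: connected_continuous_connected; first exact: component_connected.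
    apply: continuous_subspaceW rc; exact: connected_component_sub.
  have rCA : r @` C `<=` A.
    by move=> _ [y /connected_component_sub Xy <-]; exact: (F01 y Xy).2.
  have rCa : (r @` C) a.
    by exists a; [exact/connected_component_refl/AX|exact: FA].
  by apply: (connected_component_max rCa rCA rC); exists b => //; exact: FA.
(* Sends a component of A to the component of X that contains it. *)
pose phi (C : set T) := [set y | exists2 a, C a & connected_component X a y].
have phiE a : A a -> phi (connected_component A a) = connected_component X a.
  move=> Aa; apply/seteqP; split => y.
    move=> [b ab]; apply: connected_component_trans.
    have [B [Ba BA Bc] Bb] := ab.
    by exists B => //; split => //; exact: subset_trans AX.
  by move=> ay; exists a => //; exact: connected_component_refl.
rewrite card_eq_sym; apply/card_set_bijP; exists phi; split.
- by move=> _ [a Aa <-]; exists a; [exact: AX|rewrite phiE].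
- move=> C D /set_mem[a Aa <-] /set_mem[b Ab <-]; rewrite !phiE// => ab.
  apply: same_connected_component; apply: AXA => //.
  by rewrite ab; apply/connected_component_refl/AX.
- move=> _ [x Xx <-]; have Ar := (F01 x Xx).2; exists (connected_component A (r x)).
    by exists (r x).
  by rewrite phiE//; apply/esym/same_connected_component/rX.
Qed.

End DeformationRetracts.

(** * Continuity of the logarithm and of the retraction *)

Section Retraction.
Context {R : realType} {V : jbAlgebraType R}.
Implicit Types (x y z : V) (g h k : bop V).

Lemma jln_continuous y : ipos y -> {for y, continuous (@jln R V)}.
Proof.
move=> yP; have [c c0 yc] := ipos_near yP.
(* Every z within c of y satisfies c <= z <= |y| + c, so a z = 1 - z / al has norm at most r < 1,
   and ln z is ln al plus [lser (a z)]. *)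
have y0 := normr_ge0 y; pose al := `|y| + c + 1.
have al0 : 0 < al by rewrite /al; lra.
pose r := 1 - c / al.
have alr : al * r = al - c by rewrite /r mulrBr mulr1 mulrCA divff ?gt_eqF// mulr1.
have cal : 0 < c / al < 1.
  by rewrite divr_gt0//= ltr_pdivrMr// mul1r /al; lra.
have r01 : 0 < r < 1 by rewrite /r; lra.
have [r0 r1] := andP r01.
pose a z := \e - al^-1 *: z.
have ar z : `|y - z| <= c -> `|a z| <= r.
  move=> yz; apply: jpos_norm_le; first exact: ltW.
    rewrite (_ : _ - _ = al^-1 *: (z - c *: \e)).
      by apply: jposZ; [rewrite invr_ge0 ltW|exact: yc].
    by rewrite /a /r; lmod R.
  rewrite (_ : _ + _ = al^-1 *: ((2 * al - c) *: \e - z)).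
    apply: jposZ; first by rewrite invr_ge0 ltW.
    apply: jpos_norm; rewrite -(subKr y z) (le_trans (ler_normB _ _))//.
    by rewrite /al; lra.
  have aln : al != 0 by rewrite gt_eqF.
  by rewrite /a /r; lmod R.
have [k kE] := expR_total al0.
have lnE z : `|y - z| <= c -> jln z = k *: \e + lser (a z).
  move=> yz; rewrite -[RHS]jexpK; congr jln.
  have az1 : `|a z| < 1 by exact: le_lt_trans (ar z yz) r1.
  rewrite (jexpD (algZ k (alg1 (a z))) (lser_alg az1)) jexp_scalar kE.
  by rewrite jexp_lser// jmulZl jmul1x /a subKr scalerA divff ?gt_eqF// scale1r.
have [K KP] := psum_lipschitz (V := V) r0 (summable2_lser r01).
have yy : `|y - y| <= c by rewrite subrr normr0 ltW.
apply: (@lipschitz_near_continuous R V V _ y (K / al) c c0) => z yz.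
rewrite !lnE// opprD addrACA subrr add0r (le_trans (KP _ _ (ar _ yy) (ar _ yz)))//.
rewrite (_ : a y - a z = - (al^-1 *: (y - z))); last by rewrite /a; lmod R.
by rewrite normrN normrZ mulrA gtr0_norm ?invr_gt0.
Qed.

Lemma bop_eval_continuous x : continuous (fun g : bop V => g x).
Proof.
move=> g; apply: (@lipschitz_near_continuous R _ V _ g `|x| 1) => // h _.
by rewrite mulrC; exact: (opnorm_apply (g - h)).
Qed.

Lemma cvg_bop_comp (T : Type) (F : set_system T) (FF : Filter F)
    (f f' : T -> bop V) g g' :
  f @ F --> g -> f' @ F --> g' -> bop_comp (f x) (f' x) @[x --> F] --> bop_comp g g'.
Proof.
apply: (@cvg_bounded_bilinear R T F FF (bop V) (bop V) (bop V) bop_comp).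
- by move=> u v w; exact: bopE.
- by move=> u v w; apply: bopE => x; exact: (linearB u).
- move=> u v; apply: opnorm_le => x x1.
  apply: (le_trans (opnorm_apply u (v x))).
  exact: (ler_wpM2l (normr_ge0 u) (opnorm_ge v x1)).
Qed.

Lemma jL_continuous : continuous (@jL R V).
Proof.
move=> x; apply: (@lipschitz_near_continuous R V _ _ x 1 1) => // y _.
rewrite mul1r; apply: opnorm_le => z z1.
rewrite [X in `|X|](_ : _ = (x - y) ** z); last by rewrite !jbil.
by rewrite (le_trans (jnorm_mul _ _))// ler_piMr.
Qed.

Lemma jU_continuous : continuous (@jU R V).
Proof.
move=> x; apply: cvgB.
  by apply: cvgZl_tmp; apply: cvg_bop_comp; exact: jL_continuous.
apply: (continuous_cvg _ (@jL_continuous _)).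
by apply: cvg_jmul; exact: cvg_id.
Qed.

Lemma retraction_map_continuous g t : Gcone g ->
  {for (g, t), continuous (@retraction_map R V)}.
Proof.
move=> /GconeP[_ [_ _ gP _]].
have c1 : fst p @[p --> (g, t)] --> g by exact: cvg_fst.
have c2 : snd p @[p --> (g, t)] --> t by exact: cvg_snd.
have cg : (fun p : bop V * R => p.1 (\e : V)) @ (g, t) --> g \e.
  exact: (cvg_comp _ _ c1 (@bop_eval_continuous \e g)).
have cl : (fun p : bop V * R => jln (p.1 (\e : V))) @ (g, t) --> jln (g \e).
  exact: (cvg_comp _ _ cg (jln_continuous (gP _ ipos1))).
have cz : (fun p : bop V * R => - (p.2 / 2) *: jln (p.1 (\e : V))) @ (g, t) -->
    - (t / 2) *: jln (g \e).
  apply: cvgZ cl; apply: cvgN.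
  by apply: (@cvgM R); [exact: c2|exact: cvg_cst].
have ce := cvg_comp _ _ cz (@jexp_continuous _ _ _).
have cU := cvg_comp _ _ ce (@jU_continuous _).
exact: (cvg_bop_comp _ cU c1).
Qed.

Lemma jAut1 k : jAut k -> k \e = \e.
Proof.
move=> [/GLP[h [hK _]] kM].
by rewrite -[LHS]jmulx1 -{2 3}(hK \e) -kM jmul1x.
Qed.

(** An automorphism maps squares to squares, and an interior y minus a small scalar is a square. *)
Lemma jAut_Gcone : @jAut R V `<=` Gcone.
Proof.
move=> k kA; have k1 := jAut1 kA; have [/GLP[h [hK kK]] kM] := kA.
have aut_ipos g y : g \e = \e -> (forall a b, g (a ** b) = g a ** g b) ->
    ipos y -> ipos (g y).
  move=> g1 gM [c c0 yc]; have c20 : 0 < c / 2 by rewrite divr_gt0.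
  have [u _ uE] := jpos_exp yc c20; exists (c / 2) => //.
  have -> : y = jexp u + (c / 2) *: \e by rewrite -uE; lmod R.
  rewrite linearD linearZ/= g1 addrK -jexp_half_sqr gM; exact: jpos_sqr.
apply/GconeP; exists h; split => // y; apply: aut_ipos => //.
  by rewrite -[in LHS]k1 kK.
by move=> a b; rewrite -{1}(hK a) -{1}(hK b) -kM kK.
Qed.

Lemma retraction_sdr :
  strong_deformation_retract (Gcone : set (bop V)) jAut retraction_map.
Proof.
split.
- exact: jAut_Gcone.
- apply/subspace_continuousP => -[g t] [/= gG _].
  apply: cvg_within_filter; exact: retraction_map_continuous.
- by move=> g t gG _; apply: Gcone_comp => //; exact: Gcone_jU.
- move=> g gG; split.
    apply: bopE => y; rewrite /retraction_map /= mul0r oppr0 scale0r jexp0.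
    exact: U1l.
  have GG : Gcone (retraction_map (g, 1)) by apply: Gcone_comp => //; exact: Gcone_jU.
  have G1 : retraction_map (g, 1) \e = \e.
    have gP : ipos (g \e) by case/GconeP: gG => ? [_ _ + _]; apply; exact: ipos1.
    rewrite -[RHS](U_jexpNhalf (jln (g \e))) jlnK// -[LHS]/(U _ (g \e)).
    by rewrite div1r scaleNr.
  by split; [exact: GG.1|move=> a b; exact: Gcone_unital_jmul].
- move=> k t kA _; apply: bopE => y; rewrite /retraction_map /= (jAut1 kA).
  rewrite -[X in jln X]jexp0 jexpK scaler0 jexp0; exact: U1l.
Qed.

End Retraction.

Theorem theorem3p25 (R : realType) (V : jbAlgebraType R) :
  strong_deformation_retract (Gcone : set (bop V)) jAut retraction_map /\
  (connected_components (Gcone : set (bop V))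
     #= connected_components (jAut : set (bop V)))%card.
Proof.
have sdr := @retraction_sdr R V.
by split=> //; exact: connected_components_retract sdr.
Qed.
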